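(* Let $F_k$ be the free group on $k$ generators, let $\mathcal{CC}(r)=\mathcal{CC}_{F_k}(r)$ be the number of conjugacy classes of $F_k$ of length $r$ up to conjugacy, and let $\mathcal H$ be the generating function of the sequence $h_r=r\,\mathcal{CC}(r)$. Then $\mathcal H$ can be expanded as $$\mathcal H(z)=1+(k-1)\frac{z^2}{(1-z^2)^2}+\sum_{d=1}^\infty\phi(d)\left(\frac1{1-(2k-1)z^d}-1\right).$$ In particular, $\mathcal H$ has an infinite number of poles, and is not a rational function for any $k>1$. The generating function $\mathcal F[\mathcal{CC}_{F_k}]$ of the sequence $\mathcal{CC}_{F_k}(r)$ can be written as $$\mathcal F[\mathcal{CC}_{F_k}](z)=\int_0^z\frac{\mathcal H(t)}{t}\,dt,$$ and so is not a rational function either.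
   Context: Lengths are with respect to the free generating set. For $g\in F_k$, $|g|$ is the length of the shortest word in the generators and their inverses representing $g$, and $|g|_c$ is the minimum of $|h|$ over all $h$ conjugate to $g$; it depends only on the conjugacy class of $g$. $\mathcal{CC}_{F_k}(r)$ is the number of conjugacy classes $C$ of $F_k$ with $|C|_c=r$. $\phi$ is the Euler totient function. The generating function of a sequence $A=(a_0,a_1,\dots)$ is $\mathcal F[A](z)=\sum_{i=0}^\infty a_iz^i$, regarded as a function analytic at $0\in\mathbf C$.
   Formalization: The printed formulas fail (h_1=2k but printed z-coefficient is 2k-1; CC(0)=1): in the expansion ''1'' is replaced by z/(1-z)^2 and (k-1)z^2/(1-z^2)^2 by 2(k-1)z^2/(1-z^2)^2, and the integral formula becomes 1 + the integral of H(t)/t. *)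

(* Defs.v *)
From HB Require Import structures.
From Stdlib Require Import Reals.
From mathcomp Require Import all_boot finmap.
From mathcomp Require Import boolp classical_sets functions cardinality.
From Coquelicot Require Import Coquelicot.

Set Implicit Arguments.
Unset Strict Implicit.
Unset Printing Implicit Defensive.

(* The letter (i, true) stands for the i-th generator, (i, false) for its
   inverse. *)
Definition letter (k : nat) : finType := ('I_k * bool)%type.

Definition letter_inv k (a : letter k) : letter k := (a.1, ~~ a.2).

Definition reduced k (w : seq (letter k)) : bool :=
  path.sorted (fun a b => b != letter_inv a) w.

Definition push k (a : letter k) (w : seq (letter k)) : seq (letter k) :=
  if w is b :: w' then if b == letter_inv a then w' else a :: w else [:: a].

Definition reduce k (w : seq (letter k)) : seq (letter k) := foldr (@push k) [::] w.

Lemma letter_invK k : involutive (@letter_inv k).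
Proof. by move=> [i b]; rewrite /letter_inv /= negbK. Qed.

Lemma reduced_push k (a : letter k) w : reduced w -> reduced (push a w).
Proof.
case: w => [|b w] //= Hw; case: eqP => [_|/eqP nba] /=.
  exact: path_sorted Hw.
by rewrite nba.
Qed.

Lemma reduced_foldr k (u w : seq (letter k)) :
  reduced w -> reduced (foldr (@push k) w u).
Proof. by move=> Hw; elim: u => //= a u; apply: reduced_push. Qed.

Lemma reduced_reduce k (w : seq (letter k)) : reduced (reduce w).
Proof. exact: reduced_foldr. Qed.

Lemma reduce_id k (w : seq (letter k)) : reduced w -> reduce w = w.
Proof.
elim: w => //= a w IHw Hw; rewrite (IHw (path_sorted Hw)).
by case: w Hw {IHw} => //= b w /andP[/negPf-> _].
Qed.

Lemma pushK k (a : letter k) w : reduced w -> push a (push (letter_inv a) w) = w.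
Proof.
case: w => [|b w] /=; first by rewrite eqxx.
rewrite letter_invK; case: eqP => [->|_] /=; last by rewrite eqxx.
by case: w => //= c w /andP[/negPf-> _].
Qed.

Lemma foldr_push k (a : letter k) u w : reduced w ->
  foldr (@push k) w (push a u) = push a (foldr (@push k) w u).
Proof.
move=> Hw; case: u => //= b u; case: eqP => [->|] //=.
by rewrite pushK // reduced_foldr.
Qed.

Lemma foldr_reduce k (u w : seq (letter k)) : reduced w ->
  foldr (@push k) w (reduce u) = foldr (@push k) w u.
Proof. by move=> Hw; elim: u => //= a u IHu; rewrite foldr_push // IHu. Qed.

Lemma reduce_cat k (u v : seq (letter k)) :
  reduce (u ++ v) = foldr (@push k) (reduce v) u.
Proof. exact: foldr_cat. Qed.

Lemma reduce_catl k (u v : seq (letter k)) : reduce (reduce u ++ v) = reduce (u ++ v).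
Proof. by rewrite !reduce_cat foldr_reduce // reduced_reduce. Qed.

Lemma reduce_catr k (u v : seq (letter k)) : reduce (u ++ reduce v) = reduce (u ++ v).
Proof. by rewrite !reduce_cat [reduce (reduce v)]reduce_id // reduced_reduce. Qed.

Definition word_inv k (w : seq (letter k)) := rev (map (@letter_inv k) w).

Lemma reduce_invl k (w : seq (letter k)) : reduce (word_inv w ++ w) = [::].
Proof.
rewrite /word_inv; elim: w => //= a w IHw.
rewrite rev_cons cat_rcons reduce_cat /= -[X in push X (push a _)]/(letter_inv a).
rewrite -{2}[a]letter_invK pushK; last exact: reduced_reduce.
by rewrite -reduce_cat.
Qed.

Lemma word_invK k : involutive (@word_inv k).
Proof.
by move=> w; rewrite /word_inv map_rev revK mapK //; apply: letter_invK.
Qed.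

(* The free group on k generators, each element being represented by its unique
   reduced word. *)
Record free_group (k : nat) := FreeGroup {
  fg_word : seq (letter k);
  fg_wordP : reduced fg_word
}.

HB.instance Definition _ k := [isSub for @fg_word k].
HB.instance Definition _ k := [Choice of free_group k by <:].

Definition fg_of_word k (w : seq (letter k)) : free_group k :=
  FreeGroup (reduced_reduce w).

Definition fg_one k : free_group k := fg_of_word [::].
Definition fg_mul k (g h : free_group k) : free_group k :=
  fg_of_word (fg_word g ++ fg_word h).
Definition fg_inv k (g : free_group k) : free_group k :=
  fg_of_word (word_inv (fg_word g)).

Lemma fg_mulA k : associative (@fg_mul k).
Proof.
by move=> x y z; apply: val_inj; rewrite /= reduce_catl reduce_catr catA.
Qed.

Lemma fg_mul1g k : left_id (@fg_one k) (@fg_mul k).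
Proof. by move=> x; apply: val_inj; rewrite /= reduce_id //; case: x. Qed.

Lemma fg_mulg1 k : right_id (@fg_one k) (@fg_mul k).
Proof. by move=> x; apply: val_inj; rewrite /= cats0 reduce_id //; case: x. Qed.

Lemma fg_mulVg k : left_inverse (@fg_one k) (@fg_inv k) (@fg_mul k).
Proof. by move=> x; apply: val_inj; rewrite /= reduce_catl reduce_invl. Qed.

Lemma fg_mulgV k : right_inverse (@fg_one k) (@fg_inv k) (@fg_mul k).
Proof.
move=> x; apply: val_inj; rewrite /= reduce_catr.
by rewrite -{1}[fg_word x]word_invK reduce_invl.
Qed.

HB.instance Definition _ k := isGroup.Build (free_group k)
  (@fg_mulA k) (@fg_mul1g k) (@fg_mulg1 k) (@fg_mulVg k) (@fg_mulgV k).

Definition fg_gen k (i : 'I_k) : free_group k := fg_of_word [:: (i, true)].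

Definition fg_eval k (w : seq (letter k)) : free_group k :=
  (\prod_(a <- w) (if a.2 then fg_gen a.1 else (fg_gen a.1)^-1))%g.

Lemma fg_evalE k (w : seq (letter k)) : fg_eval w = fg_of_word w.
Proof.
apply: val_inj; rewrite /fg_eval; elim: w => [|[i b] w IHw]; first by rewrite big_nil.
rewrite big_cons /= IHw reduce_catr.
by case: b.
Qed.

Lemma fg_eval_word k (g : free_group k) : fg_eval (fg_word g) = g.
Proof. by apply: val_inj; rewrite fg_evalE /= reduce_id //; case: g. Qed.

(* Universal property: free_group k is free on fg_gen. *)
Lemma fg_lift_exists k (G : groupType) (f : 'I_k -> G) :
  exists phi : free_group k -> G,
    (forall x y, phi (x * y)%g = (phi x * phi y)%g) /\
    (forall i, phi (fg_gen i) = f i).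
Proof.
pose F (a : letter k) : G := (if a.2 then f a.1 else (f a.1)^-1)%g.
pose P w := (\prod_(a <- w) F a)%g.
have FV a : F (letter_inv a) = ((F a)^-1)%g.
  by case: a => i [] //=; rewrite /F /= invgK.
have Ppush a w : P (push a w) = (F a * P w)%g.
  case: w => [|b w] /=; first by rewrite /P big_cons.
  case: eqP => [->|_]; last by rewrite /P big_cons.
  by rewrite {2}/P big_cons FV mulgA mulgV mul1g.
have Pred w : P (reduce w) = P w.
  by elim: w => //= a w IHw; rewrite Ppush IHw /P big_cons.
exists (fun g => P (fg_word g)); split=> [x y|i].
  by rewrite Pred /P big_cat.
by rewrite Pred /P big_cons big_nil mulg1.
Qed.

Lemma fg_eval_ex k (g : free_group k) :
  exists n, [exists t : n.-tuple (letter k), fg_eval t == g].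
Proof.
exists (size (fg_word g)); apply/existsP; exists (in_tuple (fg_word g)).
by apply/eqP; exact: fg_eval_word.
Qed.

(* |g| *)
Definition fg_length k (g : free_group k) : nat := ex_minn (fg_eval_ex g).

Lemma conj_length_ex k (g : free_group k) :
  exists n, `[< exists x : free_group k, fg_length (g ^ x)%g = n >].
Proof. by exists (fg_length (g ^ 1)%g); apply/asboolP; exists 1%g. Qed.

(* |g|_c *)
Definition conj_length k (g : free_group k) : nat := ex_minn (conj_length_ex g).

Definition conj_class k (g : free_group k) : set (free_group k) :=
  range (fun x : free_group k => (g ^ x)%g).

Definition conj_classes_of_length (k r : nat) : set (set (free_group k)) :=
  [set C | exists2 g, C = conj_class g & conj_length g = r]%classic.

Definition CC (k r : nat) : nat := #|` fset_set (@conj_classes_of_length k r)|%fset.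

(* fset_set is only meaningful on finite sets. *)
Lemma finite_conj_classes k r : finite_set (@conj_classes_of_length k r).
Proof.
apply: (@sub_finite_set _ _
  ((fun t : r.-tuple (letter k) => conj_class (fg_eval t)) @` setT)%classic);
  last exact/finite_image/finite_finset.
move=> C [g -> ]; rewrite /conj_length; case: ex_minnP => n /asboolP[x <-] _ <-.
rewrite /fg_length; case: ex_minnP => m /existsP[t /eqP gx] _.
exists t => //; rewrite gx; apply/seteqP; split=> h [y _ <-].
  by exists (x * y)%g => //; rewrite conjgM.
by exists (x^-1 * y)%g => //; rewrite -conjgM mulgA mulgV mul1g.
Qed.

Open Scope C_scope.

(* f is, near 0, the sum of the power series with coefficients a. *)
Definition is_genfun (a : nat -> nat) (f : C -> C) : Prop :=
  locally (T := C_UniformSpace) (0 : C) (fun z =>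
    is_pseries (K := C_AbsRing) (V := C_NormedModule)
      (fun n => RtoC (INR (a n))) z (f z)).

Definition holomorphic_at (f : C -> C) (z : C) : Prop :=
  locally (T := C_UniformSpace) z (fun w =>
    ex_derive (K := C_AbsRing) (V := C_NormedModule) f w).

(* An isolated singularity at which |f| tends to infinity; the value f z itself
   is irrelevant. *)
Definition is_pole (f : C -> C) (z : C) : Prop :=
  locally' (T := C_UniformSpace) z (fun w =>
    ex_derive (K := C_AbsRing) (V := C_NormedModule) f w) /\
  filterlim (fun w => Cmod (f w)) (locally' (T := C_UniformSpace) z)
    (Rbar_locally p_infty).

Definition meromorphic_on (D : C -> Prop) (f : C -> C) : Prop :=
  forall z, D z -> holomorphic_at f z \/ is_pole f z.

Definition unit_disc (z : C) : Prop := Rlt (Cmod z) 1.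

(* p lists the coefficients of a polynomial by increasing degree. *)
Definition Cpoly_eval (p : seq C) (z : C) : C :=
  foldr (fun c s => c + z * s) (RtoC 0) p.

(* The germ of f at 0 is that of a rational function p / q, with q <> 0. *)
Definition rational_near0 (f : C -> C) : Prop :=
  exists p q : seq C,
    (exists i, nth (RtoC 0) q i <> RtoC 0) /\
    locally (T := C_UniformSpace) (0 : C) (fun z =>
      Cpoly_eval q z <> RtoC 0 -> f z = Cpoly_eval p z / Cpoly_eval q z).

(* v is the integral of f along the straight segment from a to b. *)
Definition is_segment_int (f : C -> C) (a b v : C) : Prop :=
  is_RInt (V := C_R_NormedModule)
    (fun t : R => f (a + RtoC t * (b - a)) * (b - a)) 0 1 v.

(* Main.v *)
(* Every element of F_k is conjugate to a cyclically reduced word, and two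
   cyclically reduced words are conjugate iff they are rotations of each other.
   So r CC(r) is counted by Burnside's lemma for the rotations of the cyclically
   reduced words of length r, whose number is a trace of the transfer matrix.

   The Lambert series with terms phi(d) (1/(1 - Q z^d) - 1), Q = 2k - 1, is
   rearranged into a power series: the terms with d > D give one that converges
   where |Q| |z|^(D+1) < 1.  Near any point of the unit disc, H is therefore a
   rational function plus a convergent power series.  Hence H is meromorphic in
   the disc, with poles exactly at the solutions of Q z^d = 1.  If q H = p near 0
   with p and q polynomials, the same decomposition propagates the identity, so
   q vanishes at all these poles, which are infinitely many when k > 1. *)

Require Import Defs.
From Stdlib Require Import Reals Lra.
From Stdlib Require FinFun List.
From mathcomp Require Import all_boot finmap fingroup action zmodp cyclic.
From mathcomp Require Import boolp classical_sets cardinality.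
From mathcomp Require Import zify.
From Coquelicot Require Import Coquelicot.

Set Implicit Arguments.
Unset Strict Implicit.
Unset Printing Implicit Defensive.

(** * Conjugacy classes and cyclically reduced words *)

(** The solutions of [Q z^d = 1] have modulus Q^(-1/d) and accumulate at the unit circle when Q > 1,
    so no single power series or rational function describes H on the whole disc. On a disc of
    radius rho < 1 only finitely many terms are singular, and the others sum to a power series
    centred at 0, whatever the point of interest. Continuation therefore needs no chain of discs: it
    is enough that a power series vanishing on a punctured neighbourhood of 0 has zero coefficients.
    The same splitting with D = 0, on a disc where |Q| |z| < 1, identifies the series of r CC(r)
    with H; the interchange of summations behind it rests on phi(d) <= d. Poles cannot cancel, since
    at most one term is singular at a given point of the disc. All functions are total: outside the
    unit disc the Lambert sum gets an arbitrary value, and at a pole the singular term gets the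
    default value of a division by zero. The counting is done in nat without subtraction or
    division, and passes to the reals only for the closed formula. *)

Section CyclicallyReducedWords.

Local Open Scope nat_scope.

Variable k : nat.
Implicit Types (a b : letter k) (u v w x : seq (letter k)).

Definition cycred w := path.cycle (fun a b => b != letter_inv a) w.

Lemma letter_inv_neq a : a != letter_inv a.
Proof. by case: a => i [] //; rewrite /letter_inv xpair_eqE andbF. Qed.

Lemma reduced_cat_cons u a b v :
  reduced (rcons u a ++ b :: v) =
  [&& reduced (rcons u a), b != letter_inv a & reduced (b :: v)].
Proof.
case: u => [|c u] //=.
by rewrite cat_path last_rcons /= andbA.
Qed.

Lemma reduced_word_inv w : reduced (word_inv w) = reduced w.
Proof.
rewrite /reduced /word_inv rev_sorted sorted_map; apply: eq_sorted => a b /=.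
by rewrite letter_invK eq_sym.
Qed.

Lemma cycred_cons a w : cycred (a :: w) = reduced (a :: w) && (a != letter_inv (last a w)).
Proof. by rewrite /cycred /= rcons_path. Qed.

Lemma cycred_reduced w : cycred w -> reduced w.
Proof. by case: w => // a w; rewrite cycred_cons => /andP[]. Qed.

Lemma cycred_rot i w : cycred (rot i w) = cycred w.
Proof. exact: rot_cycle. Qed.

Lemma fg_of_word_cat u v : fg_of_word (u ++ v) = (fg_of_word u * fg_of_word v)%g.
Proof. by apply: val_inj; rewrite /= reduce_catl reduce_catr. Qed.

Lemma fg_of_word_inv u : fg_of_word (word_inv u) = ((fg_of_word u)^-1)%g.
Proof.
apply/eqP; rewrite -[_ == _]/(_ == _) -(inj_eq (mulIg (fg_of_word u))) mulVg.
by apply/eqP; rewrite -fg_of_word_cat; apply: val_inj; rewrite /= reduce_invl.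
Qed.

Lemma fg_of_wordJ u x :
  (fg_of_word u ^ fg_of_word x)%g = fg_of_word (word_inv x ++ u ++ x).
Proof. by rewrite /conjg !fg_of_word_cat fg_of_word_inv. Qed.

Lemma fg_of_word_K (g : free_group k) : fg_of_word (fg_word g) = g.
Proof. by rewrite -fg_evalE fg_eval_word. Qed.

Lemma fg_of_word_inj u v : reduced u -> reduced v -> fg_of_word u = fg_of_word v -> u = v.
Proof. by move=> ru rv /(congr1 (@fg_word k)) /=; rewrite !reduce_id. Qed.

(** If a reduced word is not cyclically reduced, its first letter is the inverse of its last one,
    and conjugating by the first letter strips both. The bound on the size is what later makes
    cyclically reduced words shortest in their class. *)
Lemma conj_cycred w : reduced w -> exists u x,
  [/\ cycred u, size u <= size w & (fg_of_word w ^ fg_of_word x)%g = fg_of_word u].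
Proof.
have [n] := ubnP (size w); elim: n w => // n IHn w szw rw.
have conj1 v : (fg_of_word v ^ fg_of_word [::])%g = fg_of_word v :> free_group k.
  by rewrite fg_of_wordJ /= cats0.
case: w => [|a w] in szw rw *; first by exists [::], [::]; split.
case cw: (cycred (a :: w)); first by exists (a :: w), [::]; split; [exact: cw | exact: leqnn | exact: conj1].
move: cw; rewrite cycred_cons rw /= => /negbFE/eqP.
(* A one-letter word cannot fail to be cyclically reduced, because no letter is its own inverse. *)
case/lastP: w => [|w b] /= in szw rw *.
  by move/eqP; rewrite (negPf (letter_inv_neq a)).
rewrite last_rcons => ea.
have rw' : reduced w.
  by move: rw; rewrite /= -cats1 cat_path => /andP[/path_sorted].
have szw' : size w < n by move: szw; rewrite size_rcons !ltnS; apply: ltnW.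
have [u [x [cu szu E]]] := IHn w szw' rw'.
exists u, ([:: a] ++ x); split=> //.
  by rewrite size_rcons; apply: leq_trans szu _; rewrite ltnW.
rewrite -E fg_of_word_cat conjgM; congr (_ ^ _)%g.
rewrite -(cat1s a (rcons w b)) -cats1 !fg_of_word_cat {1}ea.
have -> : fg_of_word [:: b] = ((fg_of_word [:: a])^-1)%g.
  by rewrite ea -fg_of_word_inv /word_inv /= letter_invK.
by rewrite -{1}ea /conjg !mulgA mulVg mul1g -!mulgA mulVg mulg1.
Qed.

(* If the conjugator x cancels neither end of u, the word x^-1 u x is reduced
   but not cyclically reduced; otherwise its first letter rotates u. *)
Lemma conj_cycred_rot x u v : cycred u -> cycred v -> reduced x ->
  (fg_of_word u ^ fg_of_word x)%g = fg_of_word v -> exists i, v = rot i u.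
Proof.
elim: x u => [|a x IHx] u cu cv rx.
  rewrite fg_of_wordJ /= cats0 => /fg_of_word_inj ->; rewrite ?cycred_reduced //.
  by exists 0; rewrite rot0.
case: u => [|c u] in cu *.
  rewrite fg_of_wordJ /= => E; exists 0; rewrite rot0; apply: esym.
  apply: fg_of_word_inj; rewrite ?cycred_reduced // -E.
  by apply: val_inj; rewrite /= reduce_invl.
have rx' : reduced x := path_sorted rx.
have [->|nca] := eqVneq a c => E.
  have [i ->] : exists i, v = rot i (rot 1 (c :: u)).
    apply: IHx; rewrite ?cycred_rot // -E -(cat1s c x) fg_of_word_cat conjgM.
    congr (_ ^ _)%g; rewrite fg_of_wordJ rot1_cons -(cats1 u c) -(cat1s c u) -catA.
    by rewrite !fg_of_word_cat fg_of_word_inv mulKg.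
  by rewrite rot_rot_add; exists (rot_add (c :: u) 1 i).
have [w [b Ew]] : exists w b, c :: u = rcons w b.
  by exists (seq.belast c u), (last c u); rewrite lastI.
have [ab|nab] := eqVneq a (letter_inv b).
  have [i ->] : exists i, v = rot i (rotr 1 (c :: u)).
    apply: IHx; rewrite /cycred ?rotr_cycle // -E -(cat1s a x) fg_of_word_cat conjgM.
    congr (_ ^ _)%g; rewrite fg_of_wordJ Ew rotr1_rcons -(cats1 w b) -(cat1s b w).
    rewrite !fg_of_word_cat fg_of_word_inv ab -[[:: letter_inv b]]/(word_inv [:: b]).
    by rewrite fg_of_word_inv invgK -!mulgA mulgV mulg1.
  by rewrite /rotr rot_rot_add; eexists.
suff rW : reduced (word_inv (a :: x) ++ (c :: u) ++ a :: x).
  rewrite fg_of_wordJ in E; exfalso; move: (cv).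
  rewrite -(fg_of_word_inj rW (cycred_reduced cv) E).
  rewrite (lastI a x); move: (seq.belast a x) (last a x) => y d.
  rewrite /word_inv map_rcons rev_rcons cat_cons cycred_cons.
  by rewrite !last_cat last_rcons eqxx andbF.
rewrite /word_inv map_cons rev_cons cat_cons reduced_cat_cons.
rewrite -rev_cons -map_cons -/(word_inv (a :: x)) reduced_word_inv rx letter_invK /=.
rewrite eq_sym nca -[path _ _ _]/(reduced ((c :: u) ++ a :: x)) Ew.
by rewrite reduced_cat_cons -Ew cycred_reduced // nab.
Qed.

Lemma size_reduce w : size (reduce w) <= size w.
Proof.
elim: w => //= a w IHw; case: (reduce w) IHw => //= b u szu.
by case: ifP => // _; rewrite ltnW // ltnW.
Qed.

Lemma fg_lengthE (g : free_group k) : fg_length g = size (fg_word g).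
Proof.
rewrite /fg_length; case: ex_minnP => m /existsP[t /eqP gt] min_m.
apply/eqP; rewrite eqn_leq min_m /=; last first.
  apply/existsP; exists (in_tuple (fg_word g)); apply/eqP; exact: fg_eval_word.
by rewrite -gt fg_evalE /= -{2}(size_tuple t) size_reduce.
Qed.

(** Any conjugate g of u is conjugate to a cyclically reduced word no longer than g; this word is a
    rotation of u, so it has the size of u. *)
Lemma conj_lengthE u : cycred u -> conj_length (fg_of_word u) = size u.
Proof.
move=> cu; rewrite /conj_length; case: ex_minnP => m /asboolP[x <-] min_m.
apply/eqP; rewrite eqn_leq min_m /=; last first.
  apply/asboolP; exists 1%g; rewrite fg_lengthE.
  by rewrite conjg1 /= reduce_id // cycred_reduced.
rewrite fg_lengthE; set g := (_ ^ x)%g.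
have [v [y [cv szv E]]] := conj_cycred (fg_wordP g).
move: E; rewrite fg_of_word_K /g -(fg_of_word_K x) -conjgM -fg_of_word_cat.
rewrite -[fg_of_word (_ ++ _)]fg_of_word_K.
case/(conj_cycred_rot cu cv (fg_wordP _)) => i def_v.
by move: szv; rewrite def_v size_rot fg_of_word_K.
Qed.

Lemma conj_class_sub (g x : free_group k) :
  (conj_class (g ^ x)%g `<=` conj_class g)%classic.
Proof. by move=> _ [y _ <-]; exists (x * y)%g => //; rewrite conjgM. Qed.

Lemma conj_classJ (g x : free_group k) : conj_class (g ^ x)%g = conj_class g.
Proof.
apply/seteqP; split; first exact: conj_class_sub.
by have := @conj_class_sub (g ^ x)%g x^-1%g; rewrite conjgK.
Qed.

Lemma conj_class_rot i u :
  conj_class (fg_of_word (rot i u)) = conj_class (fg_of_word u).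
Proof.
rewrite -[in RHS](cat_take_drop i u) /rot !fg_of_word_cat.
rewrite -(conj_classJ (fg_of_word (take i u) * _)%g (fg_of_word (take i u))).
by rewrite /conjg !mulgA mulVg mul1g.
Qed.

Lemma conj_class_fg_of_word u v : cycred u -> cycred v ->
  conj_class (fg_of_word u) = conj_class (fg_of_word v) -> exists i, v = rot i u.
Proof.
move=> cu cv E; have : conj_class (fg_of_word u) (fg_of_word v).
  by rewrite E; exists 1%g => //; rewrite conjg1.
by case=> x _; rewrite -(fg_of_word_K x); apply: conj_cycred_rot; last exact: fg_wordP.
Qed.

Lemma conj_lengthJ (g x : free_group k) : conj_length (g ^ x)%g = conj_length g.
Proof.
rewrite /conj_length; case: ex_minnP => m /asboolP[y Em] min_m.
case: ex_minnP => n /asboolP[z En] min_n.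
apply/eqP; rewrite eqn_leq min_m ?min_n //; apply/asboolP.
  by exists (x * y)%g; rewrite conjgM.
by exists (x^-1 * z)%g; rewrite conjgM conjgK.
Qed.

(** This replaces group elements by a finite type of tuples, on which orbits can be counted. *)
Lemma conj_classes_of_lengthE r : @conj_classes_of_length k r =
  ((fun t : r.-tuple (letter k) => conj_class (fg_of_word t)) @`
     [set t : r.-tuple (letter k) | cycred t])%classic.
Proof.
apply/seteqP; split=> [C [g -> <-] | _ [t ct <-]]; last first.
  by exists (fg_of_word t); rewrite // conj_lengthE // size_tuple.
have [u [x [cu _ E]]] := conj_cycred (fg_wordP g).
rewrite fg_of_word_K in E.
have szu : size u == conj_length g by rewrite -(conj_lengthJ g (fg_of_word x)) E conj_lengthE.
by exists (Tuple szu) => //=; rewrite -E conj_classJ.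
Qed.

(** The orbit count below treats only positive lengths; this value gives the constant term of F. *)
Lemma CC0 : CC k 0 = 1%N.
Proof.
rewrite /CC; apply: card_fset_set; rewrite conj_classes_of_lengthE.
rewrite (_ : [set t | _]%classic = [set [tuple]]%classic); last first.
  by apply/seteqP; split=> [t _ | _ ->] //=; rewrite tuple0.
by rewrite image_set1; exact: card_set1.
Qed.

End CyclicallyReducedWords.

(** * Burnside count of rotation classes *)

Section Rotations.

Local Open Scope nat_scope.

Variables (T : finType) (n : nat).

(** The length is a successor because ['I_n.+1] then carries the group structure of Z/(n+1), whose
    product is addition modulo n+1. *)
Definition rot_act_fun (t : n.+1.-tuple T) (i : 'I_n.+1) : n.+1.-tuple T :=
  [tuple of rot i t].

Lemma rot_act1 t : rot_act_fun t 1%g = t.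
Proof. by apply: val_inj; rewrite /= rot0. Qed.

Lemma rot_actM t i j : rot_act_fun t (i * j)%g = rot_act_fun (rot_act_fun t i) j.
Proof.
apply: val_inj; rewrite /= rot_add_mod ?size_tuple ?(ltnW (ltn_ord _)) //.
rewrite addnC; case: ltngtP => [lt|gt|->].
- by rewrite modn_small.
- congr (rot _ _); rewrite -{1}(subnK (ltnW gt)) modnDr modn_small //.
  by rewrite ltn_subLR ?(ltnW gt) // -addnS leq_add // ltnW.
- by rewrite modnn rot0 -{2}(size_tuple t) rot_size.
Qed.

Definition rot_act := TotalAction rot_act1 rot_actM.

End Rotations.

Section CountClasses.

Local Open Scope nat_scope.

Variable k : nat.

Definition cycred_words r : {set r.-tuple (letter k)} := [set t : r.-tuple (letter k) | cycred t].

Lemma rot_acts_cycred n : [acts [set: 'I_n.+1], on cycred_words n.+1 | rot_act _ n].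
Proof.
apply/fintype.subsetP => i _; rewrite !inE; apply/fintype.subsetP => t; rewrite !inE /=.
by rewrite cycred_rot.
Qed.

Lemma CC_orbits n :
  CC k n.+1 = #|orbit (rot_act _ n) [set: 'I_n.+1] @: cycred_words n.+1|.
Proof.
(* Taking the union of the classes of all words of an orbit avoids choosing a representative; these
   classes are all equal. *)
pose F (A : {set n.+1.-tuple (letter k)}) : set (free_group k) :=
  [set h | exists2 t, t \in A & conj_class (fg_of_word t) h]%classic.
set X := cycred_words n.+1; set orb := orbit _ _.
have FE t : F (orb t) = conj_class (fg_of_word t).
  apply/seteqP; split=> h; last by exists t => //; exact: orbit_refl.
  by case=> _ /imsetP[i _ ->]; rewrite /= conj_class_rot.
have Finj : {in orb @: X &, injective F}.
  move=> _ _ /imsetP[t tX ->] /imsetP[u uX ->]; rewrite !FE !inE in tX uX *.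
  case/(conj_class_fg_of_word tX uX) => i def_u; apply: esym; apply/orbit_eqP.
  (* The rotation index obtained from conjugacy is an arbitrary natural number; beyond the length,
     [rot] is the identity. *)
  have [lti|gei] := ltnP i n.+1.
    by apply/imsetP; exists (Ordinal lti) => //; apply: val_inj.
  rewrite (_ : u = t) ?orbit_refl //; apply: val_inj.
  by rewrite /= def_u rot_oversize // size_tuple.
rewrite /CC (_ : fset_set _ = [fset F A | A in orb @: X]%fset).
  by rewrite card_in_imfset //= cardE.
apply/fsetP => C; rewrite in_fset_set; last exact: finite_conj_classes.
rewrite conj_classes_of_lengthE; apply/idP/imfsetP => /= [/set_mem[t ct <-]|].
  by exists (orb t); rewrite ?FE //; apply: imset_f; rewrite inE.
case=> _ /imsetP[t tX ->] ->; apply: mem_set; exists t; rewrite ?FE //.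
by rewrite inE in tX.
Qed.

(** Indices modulo the length treat the pair formed by the last and first letters like any other,
    which suits the comparison of a periodic word with its period. *)
Lemma cycredP a0 (w : seq (letter k)) :
  reflect (forall j, j < size w ->
             nth a0 w (j.+1 %% size w) != letter_inv (nth a0 w j))
          (cycred w).
Proof.
case: w => [|a w]; first by apply: ReflectT.
have nthE j : j < (size w).+1 ->
    nth a0 (rcons w a) j = nth a0 (a :: w) (j.+1 %% (size w).+1).
  rewrite nth_rcons ltnS leq_eqVlt => /orP[/eqP->|ltj].
    by rewrite ltnn eqxx modnn.
  by rewrite ltj modn_small.
apply: (iffP (pathP a0)) => /= h j ltj; last rewrite size_rcons in ltj.
  have := h j; rewrite size_rcons => /(_ ltj).
  by rewrite nthE // -rcons_cons nth_rcons /= ltj.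
by rewrite nthE // -rcons_cons nth_rcons /= ltj h.
Qed.

Lemma nth_rot (T : Type) (x0 : T) (w : seq T) i j : i < size w -> j < size w ->
  nth x0 (rot i w) j = nth x0 w ((j + i) %% size w).
Proof.
move=> lti ltj; rewrite /rot nth_cat size_drop nth_drop addnC.
case: ltnP => h; first by rewrite modn_small //; lia.
rewrite nth_take; last by lia.
have -> : j + i = (j - (size w - i)) + size w by lia.
by rewrite modnDr modn_small //; lia.
Qed.

(** Read cyclically, a word fixed by [rot i] has the periods i and [size w], hence also their
    gcd. *)
Lemma rot_fixP (T : eqType) (x0 : T) (w : seq T) i : i < size w ->
  reflect (forall j, nth x0 w (j %% size w) = nth x0 w (j %% gcdn i (size w)))
          (rot i w == w).
Proof.
move=> lti; set N := size w; set g := gcdn i N.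
have N0 : 0 < N by apply: leq_ltn_trans lti.
have g0 : 0 < g by rewrite gcdn_gt0 N0 orbT.
have gN : g <= N by rewrite dvdn_leq // dvdn_gcdr.
apply: (iffP eqP) => [fix_w j | per].
  pose h m := nth x0 w (m %% N).
  have hi m : h (m + i) = h m.
    by rewrite /h -[in RHS]fix_w nth_rot // ?ltn_mod // modnDml.
  have hki m c : h (m + c * i) = h m.
    by elim: c => [|c IHc]; rewrite ?addn0 // mulSn addnCA addnC hi.
  have hg m : h (m + g) = h m.
    (* Bezout without subtraction: a N = b i + g, so a shift by g followed by b shifts by i is a
       shift by a multiple of N. *)
    have [a b def_g _] := egcdnP i N0.
    rewrite -(hki _ b) -addnA (addnC g) /g gcdnC -def_g /h.
    by rewrite addnC modnMDl.
  have hkg m c : h (m + c * g) = h m.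
    by elim: c => [|c IHc]; rewrite ?addn0 // mulSn addnCA addnC hg.
  rewrite -/(h j) {1}(divn_eq j g) addnC hkg /h modn_small //.
  by apply: leq_trans gN; rewrite ltn_mod.
apply: (@eq_from_nth _ x0); rewrite size_rot // => j ltj.
rewrite nth_rot // per -[in RHS](modn_small ltj) per.
by rewrite -modnDmr (eqP (dvdn_gcdl i N)) addn0.
Qed.

(** A fixed word is the periodic extension of its prefix of length g. The wrap-around condition on
    the prefix is the condition between two consecutive periods, so both words are cyclically
    reduced together. *)
Lemma card_rot_fix n (i : 'I_n.+1) :
  #|('Fix_(cycred_words n.+1 | rot_act _ n)[i])%g| = #|cycred_words (gcdn i n.+1)|.
Proof.
set g := gcdn i n.+1.
have g0 : 0 < g by rewrite gcdn_gt0 orbT.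
have gN : g <= n.+1 by rewrite dvdn_leq // dvdn_gcdr.
pose ext (t : g.-tuple (letter k)) :=
  [tuple tnth t (Ordinal (ltn_pmod j g0)) | j < n.+1].
have nth_ext a0 t j : j < n.+1 -> nth a0 (ext t) j = nth a0 t (j %% g).
  by move=> ltj; rewrite -(tnth_nth a0 _ (Ordinal ltj)) tnth_mktuple (tnth_nth a0).
have ext_inj : injective ext.
  move=> t u E; apply: eq_from_tnth => j; have a0 := tnth t j.
  have ltj : j < n.+1 := leq_trans (ltn_ord j) gN.
  rewrite !(tnth_nth a0) -(modn_small (ltn_ord j)) -!nth_ext //.
  by rewrite E.
rewrite -(card_imset _ ext_inj); apply: eq_card => u.
have sz_u : size u = n.+1 := size_tuple u.
apply/setIP/imsetP => [[cu /afix1P /(congr1 val)/= /eqP fix_u] | [t ct ->{u sz_u}]].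
  pose a0 := thead u.
  have lti : i < size u by rewrite sz_u.
  have := elimT (rot_fixP a0 lti) fix_u; rewrite sz_u -/g => per.
  exists [tuple tnth u (widen_ord gN j) | j < g].
    rewrite inE; apply/(cycredP a0) => j; rewrite size_tuple => ltj.
    rewrite inE in cu; have := elimT (cycredP a0 _) cu j; rewrite sz_u.
    move/(_ (leq_trans ltj gN)).
    have E m : m < g -> nth a0 [tuple tnth u (widen_ord gN j) | j < g] m = nth a0 u m.
      by move=> ltm; rewrite -(tnth_nth a0 _ (Ordinal ltm)) tnth_mktuple (tnth_nth a0).
    by rewrite !E ?ltn_mod // per.
  apply: val_inj; apply: (@eq_from_nth _ a0); rewrite ?size_tuple // => j ltj.
  rewrite nth_ext // -[in LHS](modn_small ltj) per.
  rewrite -(tnth_nth a0 _ (Ordinal (ltn_pmod j g0))) tnth_mktuple.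
  by rewrite (tnth_nth a0).
pose a0 := tnth t (Ordinal g0).
split.
  rewrite inE; apply/(cycredP a0) => j; rewrite size_tuple => ltj.
  rewrite !nth_ext ?ltn_mod // modn_dvdm ?dvdn_gcdr // -addn1 -modnDml addn1.
  rewrite inE in ct; have := elimT (cycredP a0 _) ct (j %% g).
  by rewrite size_tuple => ->; rewrite ?ltn_mod.
apply/afix1P/val_inj/eqP/(rot_fixP a0); rewrite size_tuple // => j.
rewrite !nth_ext ?ltn_mod // -?/g ?modn_dvdm ?dvdn_gcdr ?modn_mod //.
by apply: leq_trans gN; rewrite ltn_mod.
Qed.

(** These are the elements of order d in Z/(n+1): the multiples j m of m = (n+1)/d with j < d
    coprime to d. *)
Lemma card_gcd_totient n d : d %| n.+1 ->
  #|[set i : 'I_n.+1 | n.+1 %/ gcdn i n.+1 == d]| = totient d.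
Proof.
move=> dN; set m := n.+1 %/ d.
have d0 : 0 < d by apply: dvdn_gt0 dN.
have defN : n.+1 = d * m by rewrite mulnC divnK.
have m0 : 0 < m by rewrite divn_gt0 // dvdn_leq.
have ltm (j : 'I_d) : j * m < n.+1 by rewrite [X in _ < X]defN ltn_pmul2r.
pose f (j : 'I_d) := Ordinal (ltm j).
have f_inj : injective f.
  move=> i j /(congr1 val)/= /eqP; rewrite eqn_pmul2r // => /eqP E.
  exact: val_inj.
transitivity #|[set j : 'I_d | coprime d j]|.
  rewrite -(card_imset _ f_inj); apply: eq_card => i; rewrite inE.
  have gE (j : 'I_d) : gcdn (f j) n.+1 = gcdn j d * m by rewrite muln_gcdl -defN.
  apply/eqP/imsetP => [E | [j cj ->]]; last first.
    rewrite inE coprime_sym in cj.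
    by rewrite gE (eqP cj) mul1n [in LHS]defN mulnK.
  have g0 : 0 < gcdn i n.+1 by rewrite gcdn_gt0 orbT.
  have gm : gcdn i n.+1 = m.
    by rewrite /m -E divnA ?dvdn_gcdr // mulKn.
  have mi : m %| i by rewrite -gm dvdn_gcdl.
  have lti : i %/ m < d by rewrite ltn_divLR // -defN.
  have Ei : i = f (Ordinal lti) by apply: val_inj; rewrite /= divnK.
  exists (Ordinal lti) => //; rewrite inE coprime_sym /coprime.
  by move/eqP: gm; rewrite {1}Ei gE -[X in _ == X]mul1n eqn_pmul2r.
rewrite totient_count_coprime big_mkord -sum1dep_card.
by rewrite [RHS]big_mkcond [LHS]big_mkcond; apply: eq_bigr => j _; case: coprime.
Qed.

Theorem mul_CC n : n.+1 * CC k n.+1 =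
  \sum_(d < n.+2 | d %| n.+1) totient d * #|cycred_words (n.+1 %/ d)|.
Proof.
have := Frobenius_Cauchy (rot_acts_cycred n).
rewrite [X in _ = _ * X]cardsT card_ord -CC_orbits mulnC => <-.
(* [h i] is the order of the rotation by i. It can reach n+1, hence the larger ordinal type. The
   Burnside sum is regrouped by this order. *)
pose h (i : 'I_n.+1) : 'I_n.+2 := inord (n.+1 %/ gcdn i n.+1).
have hE i : h i = n.+1 %/ gcdn i n.+1 :> nat by rewrite inordK // ltnS leq_div.
rewrite (partition_big h (fun d => d %| n.+1)) /= => [|i _]; last first.
  rewrite hE; apply/dvdnP; exists (gcdn i n.+1).
  by rewrite mulnC divnK // dvdn_gcdr.
apply: eq_bigr => d dN; rewrite -(card_gcd_totient dN) -sum_nat_cond_const.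
apply: eq_big => i; first by rewrite !inE -(inj_eq val_inj) /= hE.
case/andP=> _ /eqP<-; rewrite hE card_rot_fix.
by rewrite divnA ?dvdn_gcdr // mulKn.
Qed.

(** * Cyclically reduced words as closed walks *)

Lemma card_tuple_cons (T : finType) n (P : pred (seq T)) :
  #|[set t : n.+1.-tuple T | P t]| = \sum_a #|[set t : n.-tuple T | P (a :: t)]|.
Proof.
rewrite -sum1dep_card.
under [RHS]eq_bigr do rewrite -sum1dep_card.
rewrite (pair_big_dep xpredT (fun a (t : n.-tuple T) => P (a :: t))) /=.
rewrite (reindex (fun p : T * n.-tuple T => [tuple of p.1 :: p.2])) //=.
exists (fun t => (thead t, [tuple of behead t])) => [[a t] _ | t _] /=.
  by congr (_, _); apply: val_inj.
by rewrite -tuple_eta.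
Qed.

(** The (a, b) entry of the m-th power of the matrix of allowed successions; [t] lists the letters
    visited after the start [a]. *)
Definition walks m (a b : letter k) :=
  #|[set t : m.-tuple (letter k) |
       path (fun a b => b != letter_inv a) a t && (last a t == b)]|.

Lemma walks0 a b : walks 0 a b = (a == b).
Proof.
rewrite /walks -sum1dep_card big_mkcond (big_pred1 [tuple]) /=; last by move=> t; apply/esym/eqP; exact: tuple0.
by case: eqP.
Qed.

Lemma walksS m a b : walks m.+1 a b = \sum_(c | c != letter_inv a) walks m c b.
Proof.
rewrite /walks (card_tuple_cons _ (fun t => path _ a t && (last a t == b))).
rewrite [RHS]big_mkcond; apply: eq_bigr => c _ /=.
case: ifP => // _; exact: cards0.
Qed.

(** A cyclically reduced word is a closed walk that starts from its own last letter. For the empty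
    word this would fail: the trace is then 2k. *)
Lemma card_cycred_walks m : #|cycred_words m.+1| = \sum_a walks m.+1 a a.
Proof.
rewrite -sum1dep_card big_mkcond.
under [RHS]eq_bigr do rewrite /walks -sum1dep_card big_mkcond.
rewrite exchange_big; apply: eq_bigr => t _ /=; have a0 := thead t.
rewrite /cycred (cycle_path a0) (bigD1 (last a0 t)) //= big1 ?addn0 => [|a ne].
  have -> : last (last a0 t) t = last a0 t by case/tupleP: t.
  by rewrite eqxx andbT.
have -> : last a t = last a0 t by case/tupleP: t ne.
by rewrite eq_sym (negPf ne) andbF.
Qed.

Lemma card_letter : #|{: letter k}| = k.*2.
Proof. by rewrite card_prod card_ord card_bool muln2. Qed.

(* With J the all-ones matrix and P the matrix of a |-> a^-1, the transfer
   matrix is J - P, and 2k (J - P)^m = ((2k-1)^m - (-1)^m) J + 2k (-P)^m. *)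
Lemma walksE m a b :
  k.*2 * walks m a b + odd m * (k.*2 * (b == letter_inv a)) + ~~ odd m =
  k.*2.-1 ^ m + odd m + ~~ odd m * (k.*2 * (b == a)).
Proof.
have k0 : 0 < k.*2 by case: a => -[i lti] _; rewrite double_gt0; case: k lti.
elim: m a => [|m IHm] a; first by rewrite walks0 expn0 eq_sym /= mul0n mul1n; lia.
have card1 : \sum_(c : letter k | c != letter_inv a) 1 = k.*2.-1.
  by rewrite sum1_card cardC1 card_letter.
have sum_eq : \sum_(c : letter k | c != letter_inv a) (b == c) = (b != letter_inv a).
  have [->|ne] := eqVneq b (letter_inv a).
    by rewrite big1 // => c; rewrite eq_sym => /negPf->.
  by rewrite (bigD1 b) //= eqxx big1 ?addn0 // => c /andP[_]; rewrite eq_sym => /negPf->.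
have sum_inv : \sum_(c : letter k | c != letter_inv a) (b == letter_inv c) = (b != a).
  have E c : (b == letter_inv c) = (c == letter_inv b).
    by rewrite eq_sym (can2_eq (@letter_invK k) (@letter_invK k)).
  have [Eab|ne] := eqVneq b a.
    by rewrite big1 // => c; rewrite E Eab => /negPf->.
  rewrite (bigD1 (letter_inv b)) /=; last by rewrite (inj_eq (inv_inj (@letter_invK k))).
  by rewrite E eqxx big1 ?addn0 // => c /andP[_]; rewrite E => /negPf->.
have := eq_bigr _ (fun c _ => IHm c) : \sum_(c : letter k | c != letter_inv a) _ = \sum_(c | _) _.
rewrite !big_split /= -!big_distrr /= -walksS sum_eq sum_inv.
have sum_const x : \sum_(c : letter k | c != letter_inv a) x = k.*2.-1 * x.
  by rewrite -(mul1n x) -big_distrl card1 mul1n.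
rewrite !sum_const expnS.
by case: (odd m); case: (b == a); case: (b == letter_inv a) => /=; lia.
Qed.

(** Sum of [walksE] over the diagonal: the inversion has no fixed letter, so its matrix has trace 0.
    The common factor 2k stays because it vanishes for k = 0. *)
Lemma card_cycred m : #|cycred_words m.+1| * k.*2 + k.*2 * ~~ odd m.+1 =
  k.*2 * (k.*2.-1 ^ m.+1 + odd m.+1) + k.*2 * (~~ odd m.+1 * k.*2).
Proof.
have := eq_bigr _ (fun a _ => walksE m.+1 a a) : \sum_(a : letter k) _ = \sum_a _.
rewrite !big_split /= -!big_distrr /= -card_cycred_walks.
have -> : \sum_(a : letter k) (a == letter_inv a) = 0.
  by rewrite big1 // => a _; rewrite (negPf (letter_inv_neq a)).
have -> : \sum_(a : letter k) (a == a) = k.*2.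
  by under eq_bigr do rewrite eqxx; rewrite sum1_card card_letter.
rewrite !sum_nat_const card_letter /=.
by case: (odd m) => /=; lia.
Qed.
End CountClasses.

(** * Closed formula for r CC(r) *)

Section RealCoefficients.

Local Open Scope R_scope.

Variable k : nat.

Lemma INR_sum n (f : nat -> nat) :
  INR (\sum_(i < n.+1) f i)%N = sum_n (fun i => INR (f i)) n.
Proof.
elim: n => [|n IHn]; first by rewrite big_ord_recl big_ord0 addn0 sum_O.
by rewrite big_ord_recr /= sum_Sn -IHn plus_INR.
Qed.

Lemma INR_card_cycred m : INR #|cycred_words k m.+1| =
  (2 * INR k - 1) ^ m.+1 + 1 + 2 * (INR k - 1) * INR (~~ odd m.+1).
Proof.
(* For k = 0 the factor 2k cannot be cancelled; there are no letters, and the right-hand side is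
   (-1)^(m+1) minus itself. *)
have [k0|k0] := posnP k.
  have -> : #|cycred_words k m.+1| = 0%N.
    by rewrite card_cycred_walks big1 // => -[[i lti] c] _; move: lti; rewrite k0.
  rewrite k0 /= [_ - 1](_ : _ = -1); last by rewrite /=; lra.
  have -> : forall x, (-1) ^ x = 2 * INR (~~ odd x) - 1.
    by elim=> [|x IHx] /=; [|rewrite IHx; case: (odd x)]; rewrite /=; lra.
  by case: (odd m) => /=; lra.
have := congr1 INR (card_cycred k m).
rewrite !(plus_INR, mult_INR).
have -> : INR (k.*2.-1 ^ m.+1)%N = (2 * INR k - 1) ^ m.+1.
  have -> : 2 * INR k - 1 = INR k.*2.-1.
    have : INR k.*2.-1.+1 = 2 * INR k by rewrite prednK ?double_gt0 // -mul2n mult_INR.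
    by rewrite S_INR => <-; lra.
  by elim: m.+1 => //= x IHx; rewrite expnS mult_INR IHx.
have -> : INR k.*2 = 2 * INR k by rewrite -mul2n mult_INR /=; lra.
have k1 : 0 < INR k by apply: lt_0_INR; lia.
move=> E; apply: (Rmult_eq_reg_r (2 * INR k)); last lra.
by move: E; rewrite [odd m.+1]/=; case: (odd m) => /=; lra.
Qed.

(** The coefficient of z^n in the Lambert term of d = i+1, that is in phi(d) times the sum over m >=
    1 of Q^m z^(d m). The test [0 < n] removes the constant term. *)
Definition div_coef (Q : R) (i n : nat) : R :=
  if (i.+1 %| n)%N && (0 < n)%N then INR (totient i.+1) * Q ^ (n %/ i.+1)%N else 0.

Lemma div_coef_ge Q i n : (n <= i)%N -> div_coef Q i n = 0.
Proof.
rewrite /div_coef => le_ni; case: ifP => // /andP[/dvdn_leq le_in n0].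
by have := le_in n0; lia.
Qed.

(** The quotient n/d is even exactly when d divides n/2, so the sum is that of phi over the divisors
    of n/2. *)
Lemma sum_totient_even n :
  (\sum_(d < n.+1 | d %| n) totient d * ~~ odd (n %/ d) = if odd n then 0 else n./2)%N.
Proof.
have [n0|n0] := posnP n.
  by rewrite n0 big1 // => d; rewrite (ord1 d) mul0n.
case: ifP => odd_n.
  rewrite big1 // => d dn; have := odd_n; rewrite -{1}(divnK dn) oddM.
  by case/andP=> ->; rewrite muln0.
have [m defn] : exists m, n = (m * 2)%N.
  by exists n./2; rewrite muln2 -[LHS]odd_double_half odd_n.
have -> : n./2 = m by rewrite defn muln2 doubleK.
rewrite -[RHS](sum_totient_dvd m) (big_ord_widen_cond n.+1 (fun d => d %| m)%N totient); last by lia.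
rewrite big_mkcond [RHS]big_mkcond; apply: eq_bigr => -[d ltd] _ /=.
case dn: (d %| n)%N; last first.
  by case dm: (d %| m)%N => //; move: dn; rewrite defn dvdn_mulr.
have d0 : (0 < d)%N by apply: dvdn_gt0 dn.
have -> : (d %| m) = ~~ odd (n %/ d)%N.
  rewrite -dvdn2.
  have -> : (2 %| n %/ d)%N = (2 * d %| n)%N by rewrite -{2}(divnK dn) dvdn_pmul2r.
  by rewrite defn mulnC dvdn_pmul2r.
have dm : ~~ odd (n %/ d) -> (d < m.+1)%N.
  rewrite -dvdn2 => /dvdnP[c Ec]; rewrite ltnS.
  have E : m = (c * d)%N.
    by apply/eqP; rewrite -(eqn_pmul2r (isT : 0 < 2)%N) -defn -(divnK dn) Ec mulnAC.
  case: c E {Ec} => [|c] E; first by move: n0; rewrite defn E.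
  by rewrite E leq_pmull.
by case: (odd (n %/ d)) dm => /= [_|->] //; rewrite ?muln0 ?muln1.
Qed.

Lemma INR_sum_dvd n (f : nat -> nat) :
  INR (\sum_(d < n.+2 | d %| n.+1) f d)%N =
  sum_n (fun i => INR (if (i.+1 %| n.+1)%N then f i.+1 else 0%N)) n.
Proof.
rewrite big_mkcond big_ord_recl -(INR_sum n (fun i => if (i.+1 %| n.+1)%N then f i.+1 else 0%N)).
by have /negPf-> : ~~ ((ord0 : 'I_n.+2) %| n.+1)%N by rewrite dvd0n.
Qed.

(** In the divisor sum, the summand 1 of the word count contributes n, the parity summand
    contributes (k-1) n for even n, and the power of 2k-1 gives the Lambert coefficients. Writing
    parity with (-1)^n prepares for adding a series at z and at -z. *)
Lemma CC_coef n : INR (n * CC k n)%N =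
  INR n + (INR k - 1) / 2 * (INR n * (1 + (-1) ^ n)) +
  sum_n (fun i => div_coef (2 * INR k - 1) i n) n.
Proof.
case: n => [|n].
  by rewrite mul0n sum_O /div_coef andbF /=; lra.
rewrite mul_CC (INR_sum_dvd n (fun d => totient d * #|cycred_words k (n.+1 %/ d)|)%N).
have En : INR n.+1 = sum_n (fun i => INR (if (i.+1 %| n.+1)%N then totient i.+1 else 0)%N) n.
  by rewrite -(INR_sum_dvd n totient) sum_totient_dvd.
(* The left-hand side is half of n+1 if n+1 is even, and 0 otherwise. *)
have En2 : INR n.+1 * (1 + (-1) ^ n.+1) / 4 = sum_n (fun i => INR (if (i.+1 %| n.+1)%N then
    totient i.+1 * ~~ odd (n.+1 %/ i.+1) else 0)%N) n.
  rewrite -(INR_sum_dvd n (fun d => totient d * ~~ odd (n.+1 %/ d))%N) sum_totient_even.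
  have -> : forall x, (-1) ^ x = 1 - 2 * INR (odd x).
    by elim=> [|x IHx]; [|rewrite [odd _]/= -tech_pow_Rmult IHx; case: (odd x)]; rewrite /=; lra.
  rewrite -{1}(odd_double_half n.+1) -mul2n plus_INR mult_INR /=.
  by case: (odd n) => /=; rewrite ?[INR 2]/=; lra.
rewrite {1}En.
have -> : (INR k - 1) / 2 * (INR n.+1 * (1 + (-1) ^ n.+1)) =
  2 * (INR k - 1) * (INR n.+1 * (1 + (-1) ^ n.+1) / 4) by field.
have sumD u v : sum_n u n + sum_n v n = sum_n (fun i => u i + v i) n.
  by rewrite (sum_n_plus (G := R_AbelianMonoid)).
have sumM c u : c * sum_n u n = sum_n (fun i => c * u i) n.
  by rewrite (sum_n_mult_l (K := R_Ring)).
rewrite En2 sumM sum_Sn [div_coef _ n.+1 n.+1]div_coef_ge // plus_zero_r !sumD.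
apply: sum_n_ext => i; rewrite /div_coef andbT.
case: ifP => di; last by apply: (Rplus_eq_reg_l 0); rewrite /=; ring.
have [m Em] : exists m, (n.+1 %/ i.+1)%N = m.+1.
  by exists (n.+1 %/ i.+1)%N.-1; rewrite prednK // divn_gt0 // dvdn_leq.
rewrite mult_INR Em INR_card_cycred mult_INR.
by apply: (Rplus_eq_reg_l 0); ring.
Qed.

End RealCoefficients.

(** * Complex series and power series *)

Lemma Cplus_0_inj (x y : C) : (0 + x = 0 + y -> x = y)%C.
Proof. by rewrite !Cplus_0_l. Qed.

Lemma Cminus_eq0 (x y : C) : (x - y = 0 -> x = y)%C.
Proof. move=> E; have -> : (x = x - y + y)%C by ring.
by rewrite E Cplus_0_l. Qed.

(* ring and field look up the type of the left-hand side, which is often the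
   carrier of one of Coquelicot's structures on C instead of C itself. *)
Ltac asC := rewrite /plus /mult /scal /minus /opp /=; apply: Cplus_0_inj.
Ltac Cring := asC; ring.

Section ComplexSeries.

Local Open Scope R_scope.

Implicit Types (z w : C) (f g : C -> C).

(** The uniform structure of C is that of R x R, whose balls are squares; discs for [Cmod] define
    the same neighbourhoods. *)
Lemma locallyC z (P : C -> Prop) :
  locally (T := C_UniformSpace) z P <->
  exists2 d : R, 0 < d & forall w, Cmod (w - z) < d -> P w.
Proof.
split.
  move=> H; have [d Pd] := @locally_norm_le_locally _ C_NormedModule z P H.
  by exists d; [exact: cond_pos | exact: Pd].
case=> d d0 Pd; apply: (@locally_le_locally_norm _ C_NormedModule).
by exists (mkposreal d d0).
Qed.

Lemma locallyC' z (P : C -> Prop) :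
  locally' (T := C_UniformSpace) z P <->
  exists2 d : R, 0 < d & forall w, Cmod (w - z) < d -> w <> z -> P w.
Proof. exact: locallyC. Qed.

Lemma is_deriveC f z (l : C) :
  is_derive (K := C_AbsRing) (V := C_NormedModule) f z l <->
  forall e : R, 0 < e -> exists2 d : R, 0 < d &
    forall w, Cmod (w - z) < d ->
      Cmod (f w - f z - (w - z) * l) <= e * Cmod (w - z).
Proof.
split.
  case=> _ /(_ z (fun P H => H)) df e e0.
  have [d Pd] := df (mkposreal e e0).
  by exists d; [exact: cond_pos | exact: Pd].
move=> df; split; first exact: is_linear_scal_l.
move=> x lim_x e.
have -> : x = z by apply/esym/(is_filter_lim_locally_unique (V := AbsRing_NormedModule C_AbsRing)).
have [d d0 Pd] := df e (cond_pos e).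
by exists (mkposreal d d0).
Qed.

Lemma is_seriesC (a : nat -> C) (s : C) :
  is_series (K := C_AbsRing) (V := C_NormedModule) a s <->
  forall e : R, 0 < e -> exists N, forall n, (N <= n)%N ->
    Cmod (sum_n (G := C_AbelianMonoid) a n - s) < e.
Proof.
split.
  move=> lim_s e e0; have : locally (T := C_UniformSpace) s (fun w => Cmod (w - s) < e).
    by apply/locallyC; exists e.
  move/lim_s => [N HN]; exists N => n /leP; exact: HN.
move=> lim_s P /locallyC[d d0 Pd].
have [N HN] := lim_s d d0; exists N => n /leP Nn; exact/Pd/HN.
Qed.

Lemma pow_nC z n : pow_n (K := C_Ring) z n = Cpow z n.
Proof. by elim: n => //= n ->. Qed.

Lemma is_pseriesC (a : nat -> C) z (s : C) :
  is_pseries (K := C_AbsRing) (V := C_NormedModule) a z s <->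
  is_series (K := C_AbsRing) (V := C_NormedModule) (fun n => a n * z ^ n)%C s.
Proof.
by split; apply: is_series_ext => n; rewrite [pow_n _ _]pow_nC; [rewrite Cmult_comm | rewrite [RHS]Cmult_comm].
Qed.

Local Notation Cseries := (is_series (K := C_AbsRing) (V := C_NormedModule)).
Local Notation Csum := (sum_n (G := C_AbelianMonoid)).

Lemma Cseries_unique (a : nat -> C) (s t : C) : Cseries a s -> Cseries a t -> s = t.
Proof.
move=> /is_seriesC as_ /is_seriesC at_.
have E : Cmod (s - t) = 0.
  apply: Rle_antisym (Cmod_ge_0 _); apply: le_epsilon => e e0; rewrite Rplus_0_l.
  have [N HN] := as_ (e / 2) ltac:(lra); have [M HM] := at_ (e / 2) ltac:(lra).
  have := HN (maxn N M) (leq_maxl _ _); have := HM (maxn N M) (leq_maxr _ _).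
  set u := sum_n _ _ => h1 h2.
  have -> : (s - t = (u - t) - (u - s))%C by ring.
  apply: Rle_trans (Cmod_triangle _ _) _; rewrite Cmod_opp; lra.
exact/Cminus_eq0/Cmod_eq_0.
Qed.

Lemma Cseries_ex_abs (a : nat -> C) (b : nat -> R) :
  (forall n, Cmod (a n) <= b n) -> ex_series b -> exists s, Cseries a s.
Proof. by move=> ab; apply: (ex_series_le (V := C_CompleteNormedModule)). Qed.

Lemma Cmod_sum_n (a : nat -> C) n : Cmod (Csum a n) <= sum_n (fun i => Cmod (a i)) n.
Proof.
elim: n => [|n IHn]; first by rewrite !sum_O; apply: Rle_refl.
rewrite !sum_Sn; apply: Rle_trans (Cmod_triangle _ _) _.
exact: Rplus_le_compat_r.
Qed.

Lemma is_seriesR (a : nat -> R) (s : R) :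
  is_series a s <->
  forall e, 0 < e -> exists N, forall n, (N <= n)%N -> Rabs (sum_n a n - s) < e.
Proof.
split.
  move=> /(is_lim_seq_spec (sum_n a) s) lim e e0.
  by have [N HN] := lim (mkposreal e e0); exists N => n /leP; exact: HN.
move=> H; apply/(is_lim_seq_spec (sum_n a) s) => e.
by have [N HN] := H e (cond_pos e); exists N => n /leP; exact: HN.
Qed.

Lemma sum_n_le_series (b : nat -> R) (B : R) n :
  (forall i, 0 <= b i) -> is_series b B -> sum_n b n <= B.
Proof.
move=> b0 bB; apply: (is_lim_seq_incr_compare (sum_n b)) => // m.
by rewrite sum_Sn /plus /=; have := b0 m.+1; lra.
Qed.

Lemma Cseries_norm_le (a : nat -> C) (s : C) (B : R) :
  Cseries a s -> (forall n, Cmod (Csum a n) <= B) -> Cmod s <= B.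
Proof.
move=> /is_seriesC as_ ab; apply: le_epsilon => e e0.
have [N HN] := as_ e e0; have := HN N (leqnn N); have := ab N.
set u := Csum a N => h1 h2.
have -> : (s = u - (u - s))%C by ring.
apply: Rle_trans (Cmod_triangle _ _) _; rewrite Cmod_opp; lra.
Qed.

Lemma Cseries_scal (c : C) (a : nat -> C) (s : C) :
  Cseries a s -> Cseries (fun n => c * a n)%C (c * s)%C.
Proof. exact: (is_series_scal (V := C_NormedModule) c). Qed.

Lemma Cseries_plus (a b : nat -> C) (s t : C) :
  Cseries a s -> Cseries b t -> Cseries (fun n => a n + b n)%C (s + t)%C.
Proof. exact: is_series_plus. Qed.

Lemma RtoC_sum_n (a : nat -> R) n : RtoC (sum_n a n) = Csum (fun i => RtoC (a i)) n.
Proof. by elim: n => [|n IHn]; rewrite ?sum_O // !sum_Sn RtoC_plus IHn. Qed.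

Lemma Re_sum_n (a : nat -> C) n : Re (Csum a n) = sum_n (fun i => Re (a i)) n.
Proof. by elim: n => [|n IHn]; rewrite ?sum_O // !sum_Sn -IHn. Qed.

Lemma Cseries_Re (a : nat -> C) (s : C) :
  Cseries a s -> is_series (fun n => Re (a n)) (Re s).
Proof.
move=> /is_seriesC as_; apply/is_seriesR => e e0; have [N HN] := as_ e e0.
exists N => n /HN; apply: Rle_lt_trans; rewrite -Re_sum_n.
exact: (re_le_Cmod (_ - _)%C).
Qed.

(** * Interchange of summations *)

(** Dominated convergence for sums: past some K the tail of [M] bounds the sum uniformly in n, and
    the finitely many terms up to K tend to 0 separately. *)
Lemma tannery (D : nat -> nat -> R) (M : nat -> R) :
  (forall i n, 0 <= D i n <= M i) -> ex_series M ->
  (forall i e, 0 < e -> exists N, forall n, (N <= n)%N -> D i n < e) ->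
  forall e, 0 < e -> exists N, forall n, (N <= n)%N -> sum_n (fun i => D i n) n < e.
Proof.
move=> DM [S MS] D0 e e0.
have M0 i : 0 <= M i by have := DM i 0%N; lra.
have [K HK] := (proj1 (is_seriesR _ _) MS) (e / 2) ltac:(lra).
have {}HK := HK K (leqnn K).
have head : exists N, forall n, (N <= n)%N -> sum_n (fun i => D i n) K < e / 2.
  elim: K {HK} (e / 2) (ltac:(lra) : 0 < e / 2) => [|K IHK] r r0.
    by have [N HN] := D0 0%N r r0; exists N => n; rewrite sum_O; exact: HN.
  have [N HN] := IHK (r / 2) ltac:(lra).
  have [N' HN'] := D0 K.+1 (r / 2) ltac:(lra).
  exists (maxn N N') => n; rewrite geq_max => /andP[/HN h /HN' h'].
  by rewrite sum_Sn /plus /=; lra.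
have [N HN] := head; exists (maxn N K) => n; rewrite geq_max => /andP[Nn Kn].
have tail m : sum_n (fun i => D i n) (K + m) - sum_n (fun i => D i n) K <=
    sum_n M (K + m) - sum_n M K.
  elim: m => [|m IHm]; first by rewrite addn0; lra.
  by rewrite addnS !sum_Sn /plus /=; have := DM (K + m).+1 n; lra.
have := tail (n - K)%N; rewrite subnKC // => t1.
have := sum_n_le_series n M0 MS; have := HN n Nn.
by move: HK => /Rabs_def2; lra.
Qed.

Lemma sum_n_triangle (c : nat -> nat -> C) N :
  (forall i n, (n < i)%N -> c i n = 0) ->
  Csum (fun n => Csum (fun i => c i n) n) N = Csum (fun i => Csum (c i) N) N.
Proof.
move=> c0; rewrite sum_n_switch; apply: sum_n_ext_loc => n /leP le_nN.
rewrite -(subnKC le_nN); elim: (N - n)%N => [|m IHm]; first by rewrite addn0.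
rewrite addnS [RHS]sum_Sn -IHm [c (n + m).+1 n]c0 ?ltnS ?leq_addr //.
by rewrite [RHS]plus_zero_r.
Qed.

(** The partial column sums differ from those of [A] by row remainders, which [tannery] handles with
    the majorant 2 M. Triangularity keeps each column finite. *)
Lemma double_series (c : nat -> nat -> C) (A : nat -> C) (M : nat -> R) :
  (forall i n, (n < i)%N -> c i n = 0) ->
  (forall i, Cseries (c i) (A i)) ->
  (forall i N, Cmod (Csum (c i) N) <= M i) -> ex_series M ->
  exists2 S, Cseries A S & Cseries (fun n => Csum (fun i => c i n) n) S.
Proof.
move=> c0 cA cM exM.
have AM i : Cmod (A i) <= M i by apply: Cseries_norm_le (cA i) (cM i).
have [S AS] := Cseries_ex_abs AM exM.
exists S => //; apply/is_seriesC => e e0.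
have [N1 H1] := proj1 (is_seriesC _ _) AS (e / 2) ltac:(lra).
pose D i n := Cmod (Csum (c i) n - A i).
have DM i n : 0 <= D i n <= 2 * M i.
  split; first exact: Cmod_ge_0.
  apply: Rle_trans (Cmod_triangle _ _) _; rewrite Cmod_opp.
  by have := cM i n; have := AM i; lra.
have ex2M : ex_series (fun i => 2 * M i) by apply: (ex_series_scal 2).
have Dlim i r : 0 < r -> exists N, forall n, (N <= n)%N -> D i n < r.
  exact: (proj1 (is_seriesC _ _) (cA i)).
have [N2 H2] := tannery DM ex2M Dlim (e := e / 2) ltac:(lra).
exists (maxn N1 N2) => n; rewrite geq_max => /andP[/H1 h1 /H2 h2].
rewrite sum_n_triangle //.
have -> : (Csum (fun i => Csum (c i) n) n - S =
  (Csum (fun i => Csum (c i) n - A i) n) + (Csum A n - S))%C.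
  have -> : Csum (fun i => Csum (c i) n) n = (Csum (fun i => Csum (c i) n - A i) n + Csum A n)%C.
    apply: eq_trans (sum_n_plus (G := C_AbelianMonoid) _ _ _); apply: sum_n_ext => i.
    by Cring.
  by Cring.
apply: Rle_lt_trans (Cmod_triangle _ _) _.
have := Cmod_sum_n (fun i => Csum (c i) n - A i)%C n.
by rewrite /D in h2; lra.
Qed.

Lemma Cgeom_sum z n : z <> 1 -> Csum (fun i => z ^ i)%C n = ((1 - z ^ n.+1) / (1 - z))%C.
Proof.
move=> z1; have z1' : (1 - z <> 0)%C.
  by move=> E; apply: z1; rewrite -[LHS]Cplus_0_l -E; ring.
elim: n => [|n IHn]; first by rewrite sum_O /=; field.
by rewrite sum_Sn IHn; asC; field.
Qed.

Lemma Cmod_pow_small z e : Cmod z < 1 -> 0 < e ->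
  exists N, forall n, (N <= n)%N -> Cmod (z ^ n) < e.
Proof.
move=> z1 e0; have := pow_lt_1_zero (Cmod z) _ e e0.
rewrite Rabs_pos_eq; last exact: Cmod_ge_0.
move=> /(_ z1)[N HN]; exists N => n /leP/HN; rewrite -RPow_abs Rabs_pos_eq ?Cmod_pow //.
exact: Cmod_ge_0.
Qed.

Lemma Cmod_1_minus z : 1 - Cmod z <= Cmod (1 - z).
Proof.
have := Cmod_triangle (1 - z) z.
have -> : (1 - z + z = 1)%C by ring.
by rewrite Cmod_1; lra.
Qed.

Lemma Cmod_lt1_neq1 z : Cmod z < 1 -> z <> 1.
Proof. by move=> z1 E; move: z1; rewrite E Cmod_1; lra. Qed.

Lemma Cgeom_series z : Cmod z < 1 -> Cseries (fun n => z ^ n)%C (1 / (1 - z))%C.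
Proof.
move=> z1; apply/is_seriesC => e e0.
have zn1 := Cmod_lt1_neq1 z1.
have z1' : (1 - z <> 0)%C.
  by move=> E; apply: zn1; rewrite -[LHS]Cplus_0_l -E; ring.
have d0 : 0 < Cmod (1 - z) by apply/Cmod_gt_0.
have [N HN] := Cmod_pow_small z1 (Rmult_lt_0_compat _ _ e0 d0).
exists N => n Nn; rewrite Cgeom_sum //.
have -> : ((1 - z ^ n.+1) / (1 - z) - 1 / (1 - z) = - z ^ n.+1 / (1 - z))%C by field.
rewrite Cmod_div // Cmod_opp; apply: (Rmult_lt_reg_r (Cmod (1 - z))) => //.
rewrite /Rdiv Rmult_assoc Rinv_l ?Rmult_1_r; last lra.
exact: HN (leqW Nn).
Qed.

(** * Lambert terms and tails as power series *)

Definition lambert (Q : R) (i : nat) z : C :=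
  (RtoC (INR (totient i.+1)) * (1 / (1 - RtoC Q * z ^ i.+1) - 1))%C.

(** Up to degree N only the multiples of i+1 occur, so the partial sum is a geometric one up to
    N/(i+1) without its term 1. *)
Lemma div_coef_sum Q i z N :
  Csum (fun n => RtoC (div_coef Q i n) * z ^ n)%C N =
  (RtoC (INR (totient i.+1)) *
     (Csum (fun m => (RtoC Q * z ^ i.+1) ^ m) (N %/ i.+1) - 1))%C.
Proof.
elim: N => [|N IHN].
  by rewrite sum_O div0n sum_O /div_coef andbF /=; ring.
rewrite sum_Sn IHN /div_coef andbT; case: ifP => dN; last first.
  by rewrite divnS // dN add0n; Cring.
have Ew : (RtoC (Q ^ (N.+1 %/ i.+1)) * z ^ N.+1 = (RtoC Q * z ^ i.+1) ^ (N %/ i.+1).+1)%C.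
  rewrite RtoC_pow Cpow_mult_l -Cpow_mult_r multE.
  have -> : (N %/ i.+1).+1 = (N.+1 %/ i.+1)%N by rewrite divnS // dN.
  by rewrite [X in _ = (_ * _ ^ X)%C]mulnC divnK.
by rewrite RtoC_mult -Cmult_assoc Ew divnS // dN add1n sum_Sn; Cring.
Qed.

Lemma lambert_series Q i z : Cmod (RtoC Q * z ^ i.+1) < 1 ->
  Cseries (fun n => RtoC (div_coef Q i n) * z ^ n)%C (lambert Q i z).
Proof.
move=> w1; have gs := Cgeom_series w1.
apply/is_seriesC => e e0.
have t0 : 0 < INR (totient i.+1) by apply: lt_0_INR; apply/ltP; rewrite totient_gt0.
have [N HN] := proj1 (is_seriesC _ _) gs (e / INR (totient i.+1)) (Rdiv_lt_0_compat _ _ e0 t0).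
exists (N * i.+1)%N => n; rewrite -leq_divRL // => Nn.
rewrite div_coef_sum /lambert.
set u := Csum _ _; set v := (1 / _)%C.
have -> : (RtoC (INR (totient i.+1)) * (u - 1) - RtoC (INR (totient i.+1)) * (v - 1) =
  RtoC (INR (totient i.+1)) * (u - v))%C by ring.
rewrite Cmod_mult Cmod_R Rabs_pos_eq; last lra.
have := HN _ Nn; rewrite -/u -/v => h.
apply: (Rmult_lt_reg_r (/ INR (totient i.+1))); first exact: Rinv_0_lt_compat.
rewrite Rmult_comm -Rmult_assoc Rinv_l ?Rmult_1_l //; lra.
Qed.

(** The factor 2 comes from |w - w^(m+1)| <= 2 |w|. The bound is uniform in N and proportional to
    x^(i+1), hence summable over i. *)
Lemma lambert_bound Q i z x N : Cmod z <= x -> Rabs Q * x ^ i.+1 < 1 ->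
  Cmod (Csum (fun n => RtoC (div_coef Q i n) * z ^ n)%C N) <=
  INR (totient i.+1) * (2 * (Rabs Q * x ^ i.+1) / (1 - Rabs Q * x ^ i.+1)).
Proof.
move=> zx y1; set y := Rabs Q * _ in y1 *.
rewrite div_coef_sum Cmod_mult Cmod_R Rabs_pos_eq; last exact: pos_INR.
apply: Rmult_le_compat_l; first exact: pos_INR.
set w := (RtoC Q * z ^ i.+1)%C; set m := (_ %/ _)%N.
have wy : Cmod w <= y.
  rewrite Cmod_mult Cmod_R Cmod_pow; apply: Rmult_le_compat_l; first exact: Rabs_pos.
  by apply: pow_incr; split=> //; exact: Cmod_ge_0.
have w1 : Cmod w < 1 by lra.
have w0 := Cmod_ge_0 w.
have w1' : (1 - w <> 0)%C.
  by move=> E; apply: (Cmod_lt1_neq1 w1); rewrite -[LHS]Cplus_0_l -E; ring.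
rewrite Cgeom_sum; last exact: Cmod_lt1_neq1.
have -> : ((1 - w ^ m.+1) / (1 - w) - 1 = (w - w ^ m.+1) / (1 - w))%C by field.
rewrite Cmod_div //; apply: Rmult_le_compat; first exact: Cmod_ge_0.
- by apply/Rlt_le/Rinv_0_lt_compat/Cmod_gt_0.
- apply: Rle_trans (Cmod_triangle _ _) _; rewrite Cmod_opp Cmod_pow /=.
  have : Cmod w ^ m <= 1 by rewrite -(pow1 m); apply: pow_incr; lra.
  have := pow_le _ m w0; nra.
- by apply: Rinv_le_contravar; [lra | have := Cmod_1_minus w; lra].
Qed.

(** The left-hand side is one term of the binomial expansion on the right. A factor n+1 thus costs
    only a slightly larger radius. *)
Lemma pow_derive_le x d n : 0 <= x -> 0 <= d ->
  INR n.+1 * x ^ n * d <= (x + d) ^ n.+1.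
Proof.
move=> x0 d0; elim: n => [|n IHn]; first by rewrite /=; lra.
have xd : x ^ n.+1 <= (x + d) ^ n.+1 by apply: pow_incr; lra.
have h1 := Rmult_le_compat_l _ _ _ x0 IHn.
have h2 := Rmult_le_compat_l _ _ _ d0 xd.
rewrite [(x + d) ^ n.+2]/= -/((x + d) ^ n.+1) S_INR.
by move: h1 h2; rewrite [(x + d) ^ n.+1]/= [x ^ n.+1]/=; lra.
Qed.

Lemma ex_series_INR_pow x : 0 <= x < 1 -> ex_series (fun n => INR n.+1 * x ^ n).
Proof.
move=> [x0 x1]; set d := (1 - x) / 2; have d0 : 0 < d by rewrite /d; lra.
have exg : ex_series (fun n => / d * (x + d) * (x + d) ^ n).
  apply: (ex_series_scal (/ d * (x + d))); exists (/ (1 - (x + d))).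
  by apply: is_series_geom; rewrite Rabs_pos_eq /d; lra.
apply: ex_series_le exg => n; rewrite [norm _]Rabs_pos_eq; last first.
  by apply: Rmult_le_pos; [exact: pos_INR | exact: pow_le].
apply: (Rmult_le_reg_r d) => //; apply: Rle_trans (pow_derive_le n x0 (Rlt_le _ _ d0)) _.
by apply: Req_le; rewrite /=; field; lra.
Qed.

(** The coefficient of z^n in the sum of the Lambert terms with d > D; the sum may stop at n because
    only d <= n contribute. *)
Definition tail_coef Q D n : R :=
  sum_n (fun i => if (i < D)%N then 0 else div_coef Q i n) n.

Lemma totient_le_INR i : INR (totient i.+1) <= INR i.+1.
Proof.
apply/le_INR/leP; rewrite totient_count_coprime.
by rewrite -[X in (_ <= X)%N]subn0 -[X in (_ <= X)%N]muln1 -sum_nat_const_nat leq_sum // => j _; case: coprime.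
Qed.

Lemma lambert_tail Q D z x : Cmod z <= x -> x < 1 -> Rabs Q * x ^ D.+1 < 1 ->
  exists2 T, Cseries (fun i => if (i < D)%N then RtoC 0 else lambert Q i z) T &
    Cseries (fun n => RtoC (tail_coef Q D n) * z ^ n)%C T.
Proof.
move=> zx x1 y1; have z0 := Cmod_ge_0 z; have x0 : 0 <= x by lra.
have Q0 := Rabs_pos Q.
set y := Rabs Q * x ^ D.+1 in y1 *.
have yi i : (D <= i)%N -> 0 <= Rabs Q * x ^ i.+1 <= y.
  move=> Di; split; first by apply: Rmult_le_pos => //; exact: pow_le.
  apply: Rmult_le_compat_l => //; rewrite -(subnK Di) -addnS pow_add.
  have xp := pow_le x D.+1 x0.
  have : x ^ (i - D) <= 1 by rewrite -(pow1 (i - D)); apply: pow_incr; lra.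
  by nra.
pose c i n := (if (i < D)%N then RtoC 0 else RtoC (div_coef Q i n) * z ^ n)%C.
(* This is the bound of [lambert_bound] with phi(i+1) replaced by i+1 and every denominator by its
   lower bound 1 - y. *)
pose M i := 2 * Rabs Q * x / (1 - y) * (INR i.+1 * x ^ i).
have csum0 i N : (i < D)%N -> Csum (c i) N = RtoC 0.
  move=> iD; elim: N => [|N IHN]; first by rewrite sum_O /c iD.
  by rewrite sum_Sn IHN /c iD; Cring.
have [||||T T1 T2] := @double_series c (fun i => if (i < D)%N then RtoC 0 else lambert Q i z) M.
- by move=> i n ni; rewrite /c; case: ifP => // _; rewrite div_coef_ge 1?ltnW // Cmult_0_l.
- move=> i; rewrite {1}/c; case: ltnP => iD.
    apply/is_seriesC => e e0; exists 0%N => N _.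
    have := csum0 i N iD; rewrite /c iD => ->.
    have -> : (RtoC 0 - RtoC 0 = RtoC 0)%C by ring.
    by rewrite Cmod_0.
  apply: lambert_series; rewrite Cmod_mult Cmod_R Cmod_pow.
  have := yi i iD; have : Cmod z ^ i.+1 <= x ^ i.+1 by apply: pow_incr.
  by move/(Rmult_le_compat_l _ _ _ Q0); lra.
- move=> i N; case: (ltnP i D) => iD.
    rewrite csum0 // Cmod_0 /M; apply: Rmult_le_pos.
      apply: Rmult_le_pos; last by apply/Rlt_le/Rinv_0_lt_compat; lra.
      by apply: Rmult_le_pos => //; lra.
    by apply: Rmult_le_pos; [exact: pos_INR | exact: pow_le].
  have [yi0 yi1] := yi i iD.
  rewrite (sum_n_ext (G := C_AbelianMonoid) _ (fun n => RtoC (div_coef Q i n) * z ^ n)%C); last first.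
    by move=> n; rewrite /c ltnNge iD.
  apply: Rle_trans (lambert_bound _ zx _) _; first by lra.
  have inv_le : / (1 - Rabs Q * x ^ i.+1) <= / (1 - y) by apply: Rinv_le_contravar; lra.
  have inv0 : 0 < / (1 - Rabs Q * x ^ i.+1) by apply: Rinv_0_lt_compat; lra.
  have h := Rmult_le_compat _ _ _ _ (pos_INR _) (Rlt_le _ _ inv0) (totient_le_INR i) inv_le.
  have := Rmult_le_compat_l (2 * (Rabs Q * x ^ i.+1)) _ _ ltac:(lra) h.
  by rewrite /M /Rdiv /=; lra.
- by apply: (ex_series_scal (2 * Rabs Q * x / (1 - y))); apply: ex_series_INR_pow.
exists T => //; apply: is_series_ext T2 => n.
rewrite /tail_coef RtoC_sum_n.
apply: eq_trans (sum_n_mult_r (K := C_Ring) _ _ _); apply: sum_n_ext => i; rewrite /c; case: ifP => // _; Cring.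
Qed.

Lemma tail_coef_abs Q D n : Rabs (tail_coef Q D n) <= tail_coef (Rabs Q) D n.
Proof.
have le m : Rabs (sum_n (fun i => if (i < D)%N then 0 else div_coef Q i n) m) <=
    sum_n (fun i => if (i < D)%N then 0 else div_coef (Rabs Q) i n) m; last exact: le.
have le1 i : Rabs (if (i < D)%N then 0 else div_coef Q i n) <=
    (if (i < D)%N then 0 else div_coef (Rabs Q) i n).
  case: ifP => _; first by rewrite Rabs_R0; lra.
  rewrite /div_coef; case: ifP => _; last by rewrite Rabs_R0; lra.
  rewrite Rabs_mult RPow_abs Rabs_pos_eq; [lra | exact: pos_INR].
elim: m => [|m IHm]; first by rewrite !sum_O; exact: le1.
rewrite !sum_Sn; apply: Rle_trans (Rabs_triang _ _) _.
by apply: Rplus_le_compat.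
Qed.

(** Replacing Q by |Q| gives a majorant with nonnegative coefficients, already summed at the real
    point x. *)
Lemma tail_coef_ex_series Q D x : 0 <= x < 1 -> Rabs Q * x ^ D.+1 < 1 ->
  ex_series (fun n => Rabs (tail_coef Q D n) * x ^ n).
Proof.
move=> [x0 x1] y1.
have [|||T _ /Cseries_Re T2] := @lambert_tail (Rabs Q) D (RtoC x) x.
- by rewrite Cmod_R Rabs_pos_eq //; lra.
- by [].
- by rewrite Rabs_Rabsolu.
apply: (ex_series_le (V := R_CompleteNormedModule) _ _ _ (ex_intro _ _ T2)) => n.
rewrite -RtoC_pow -RtoC_mult /= [norm _]Rabs_pos_eq; last first.
  by apply: Rmult_le_pos; [exact: Rabs_pos | exact: pow_le].
by apply: Rmult_le_compat_r; [exact: pow_le | exact: tail_coef_abs].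
Qed.

(** * Functions given by a power series at 0 *)

(** Absolute convergence is part of the definition, so that termwise bounds are available without an
    Abel lemma. *)
Definition PSum (a : nat -> C) (rho : R) f := forall z, Cmod z < rho ->
  ex_series (fun n => Cmod (a n) * Cmod z ^ n) /\ Cseries (fun n => a n * z ^ n)%C (f z).

Lemma PSum_ext a b rho f g : (forall n, a n = b n) ->
  (forall z, Cmod z < rho -> f z = g z) -> PSum a rho f -> PSum b rho g.
Proof.
move=> ab fg fP z zr; have [h1 h2] := fP z zr; rewrite -fg //; split.
  by apply: ex_series_ext h1 => n; rewrite ab.
by apply: is_series_ext h2 => n; rewrite ab.
Qed.

Lemma PSum_abs a rho f x : PSum a rho f -> 0 <= x < rho ->
  ex_series (fun n => Cmod (a n) * x ^ n).
Proof.
move=> fP x0; have [] := fP (RtoC x); first by rewrite Cmod_R Rabs_pos_eq; lra.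
by rewrite Cmod_R Rabs_pos_eq //; lra.
Qed.

Lemma PSum_of_abs a rho :
  (forall x, 0 <= x < rho -> ex_series (fun n => Cmod (a n) * x ^ n)) ->
  exists f, PSum a rho f.
Proof.
move=> aP.
have /boolp.choice[f fP] : forall z, exists s, Cmod z < rho -> Cseries (fun n => a n * z ^ n)%C s.
  move=> z; have [zr|zr] := Rlt_dec (Cmod z) rho; last by exists (RtoC 0).
  have := aP (Cmod z) (conj (Cmod_ge_0 z) zr).
  case/(@Cseries_ex_abs (fun n => a n * z ^ n)%C) => [n|s sP]; last by exists s.
  by rewrite Cmod_mult Cmod_pow; apply: Rle_refl.
exists f => z zr; split; last exact: fP.
by apply: aP; split=> //; exact: Cmod_ge_0.
Qed.

(** Binomially, the remainder has terms of degree j >= 2 in h, and |h|^j <= |h|^2 d^(j-2).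
    Multiplying by d^2 avoids a division in the induction. *)
Lemma pow_taylor1 z h d n : Cmod h <= d ->
  Cmod ((z + h) ^ n - z ^ n - RtoC (INR n) * z ^ n.-1 * h) * d ^ 2 <=
  Cmod h ^ 2 * ((Cmod z + d) ^ n - Cmod z ^ n - INR n * Cmod z ^ n.-1 * d).
Proof.
move=> hd; have h0 := Cmod_ge_0 h; have z0 := Cmod_ge_0 z.
elim: n => [|n IHn].
  have -> : ((z + h) ^ 0 - z ^ 0 - RtoC (INR 0) * z ^ 0.-1 * h = 0)%C by rewrite /=; ring.
  by rewrite Cmod_0 /=; lra.
set E := ((z + h) ^ n - _ - _)%C in IHn *.
set r := _ - _ - _ in IHn *.
have Er : ((z + h) ^ n.+1 - z ^ n.+1 - RtoC (INR n.+1) * z ^ n.+1.-1 * h =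
  (z + h) * E + RtoC (INR n) * z ^ n.-1 * h * h)%C.
  rewrite S_INR RtoC_plus /E /=; case: n {IHn E r} => [|n] /=; ring.
have Rr : (Cmod z + d) ^ n.+1 - Cmod z ^ n.+1 - INR n.+1 * Cmod z ^ n.+1.-1 * d =
  (Cmod z + d) * r + INR n * Cmod z ^ n.-1 * d * d.
  by rewrite S_INR /r /=; case: n {IHn E r Er} => [|n] /=; ring.
rewrite Er Rr.
have t1 := Cmod_triangle ((z + h) * E) (RtoC (INR n) * z ^ n.-1 * h * h).
rewrite !Cmod_mult Cmod_R Cmod_pow Rabs_pos_eq in t1; last exact: pos_INR.
have t2 := Cmod_triangle z h; have E0 := Cmod_ge_0 E.
have d2 : 0 <= d ^ 2 by apply: pow2_ge_0.
apply: Rle_trans (Rmult_le_compat_r _ _ _ d2 t1) _.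
have t3 : Cmod (z + h) * Cmod E <= (Cmod z + d) * Cmod E by apply: Rmult_le_compat_r => //; lra.
have t4 := Rmult_le_compat_r _ _ _ d2 t3.
have t5 := Rmult_le_compat_l (Cmod z + d) _ _ ltac:(lra) IHn.
by rewrite /= in t4 t5 *; lra.
Qed.

(** By [pow_taylor1], the Taylor remainder of f is at most |h|^2 / d^2 times the sum B of the moduli
    at radius |z| + d < rho. *)
Lemma PSum_derive a rho f : PSum a rho f ->
  exists2 g, PSum (fun n => RtoC (INR n.+1) * a n.+1)%C rho g &
    forall z, Cmod z < rho -> is_derive (K := C_AbsRing) (V := C_NormedModule) f z (g z).
Proof.
move=> fP.
have [|g gP] := @PSum_of_abs (fun n => RtoC (INR n.+1) * a n.+1)%C rho.
  move=> x [x0 xr]; set d := (rho - x) / 2; have d0 : 0 < d by rewrite /d; lra.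
  have := PSum_abs fP (x := x + d) ltac:(rewrite /d; lra).
  move=> /ex_series_incr_1 /(ex_series_scal (/ d)).
  apply: ex_series_le => n; rewrite [norm _]Rabs_pos_eq; last first.
    by apply: Rmult_le_pos; [exact: Cmod_ge_0 | exact: pow_le].
  rewrite Cmod_mult Cmod_R Rabs_pos_eq; last exact: pos_INR.
  have h := pow_derive_le n x0 (Rlt_le _ _ d0).
  have := Rmult_le_compat_l _ _ _ (Cmod_ge_0 (a n.+1)) h.
  move=> h2; apply: (Rmult_le_reg_r d) => //.
  rewrite /scal /= /mult /= in h2 *.
  have -> : / d * (Cmod (a n.+1) * ((x + d) * (x + d) ^ n)) * d =
            Cmod (a n.+1) * ((x + d) * (x + d) ^ n) by field; lra.
  by lra.
exists g => // z zr; have [_ gz] := gP z zr; have [_ fz] := fP z zr.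
set d := (rho - Cmod z) / 2; have d0 : 0 < d by rewrite /d; lra.
have z0 := Cmod_ge_0 z.
have [B aB] := PSum_abs fP (x := Cmod z + d) ltac:(rewrite /d; lra).
have B0 : 0 <= B.
  apply: Rle_trans (sum_n_le_series 0 _ aB) => [|i]; first rewrite sum_O.
    by apply: Rmult_le_pos; [exact: Cmod_ge_0 | apply: pow_le; lra].
  by apply: Rmult_le_pos; [exact: Cmod_ge_0 | apply: pow_le; lra].
have gz' : Cseries (fun n => RtoC (INR n) * a n * z ^ n.-1)%C (g z).
  apply: is_series_decr_1.
  have -> : plus (g z) (opp (RtoC (INR 0) * a 0%N * z ^ 0.-1)%C) = g z by Cring.
  exact: gz.
apply/is_deriveC => e e0.
have d2 : 0 < d ^ 2 by apply: pow_lt.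
have ed : 0 < e * d ^ 2 / (B + 1).
  by apply: Rdiv_lt_0_compat; [apply: Rmult_lt_0_compat | lra].
(* The second bound makes |h| B / d^2 at most e; B + 1 replaces B, which may be 0. *)
exists (Rmin d (e * d ^ 2 / (B + 1))); first exact: Rmin_pos.
move=> w wz; set h := (w - z)%C in wz *.
have hd : Cmod h < d by apply: Rlt_le_trans wz (Rmin_l _ _).
have he : Cmod h < e * d ^ 2 / (B + 1) by apply: Rlt_le_trans wz (Rmin_r _ _).
have defw : w = (z + h)%C by rewrite /h; ring.
have wr : Cmod w < rho.
  by rewrite defw; have := Cmod_triangle z h; rewrite /d in hd; lra.
have [_ fw] := fP w wr.
have SE : Cseries (fun n => a n * ((z + h) ^ n - z ^ n - RtoC (INR n) * z ^ n.-1 * h))%C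
    (f w - f z - h * g z)%C.
  have := Cseries_plus fw (Cseries_plus (Cseries_scal (c := (-1)%C) fz) (Cseries_scal (c := (- h)%C) gz')).
  have -> : (f w + (-1 * f z + - h * g z) = f w - f z - h * g z)%C by ring.
  by apply: is_series_ext => n; rewrite defw; Cring.
have bnd : Cmod (f w - f z - h * g z) <= Cmod h ^ 2 / d ^ 2 * B.
  apply: Cseries_norm_le SE _ => n; apply: Rle_trans (Cmod_sum_n _ _) _.
  have sB : is_series (fun n => Cmod h ^ 2 / d ^ 2 * (Cmod (a n) * (Cmod z + d) ^ n)) (Cmod h ^ 2 / d ^ 2 * B).
    exact: (is_series_scal (V := R_NormedModule)).
  have c0 : 0 <= Cmod h ^ 2 / d ^ 2.
    by apply: Rdiv_le_0_compat => //; apply: pow2_ge_0.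
  apply: Rle_trans (sum_n_le_series n _ sB) => [|i]; last first.
    apply: Rmult_le_pos => //.
    by apply: Rmult_le_pos; [exact: Cmod_ge_0 | apply: pow_le; lra].
  rewrite !sum_n_Reals; apply: sum_Rle => i _; rewrite Cmod_mult.
  have := pow_taylor1 z i (Rlt_le _ _ hd).
  set Er := Cmod (_ - _) => tl.
  have p1 : 0 <= Cmod z ^ i by apply: pow_le.
  have p2 : 0 <= INR i * Cmod z ^ i.-1 * d.
    by apply: Rmult_le_pos; [apply: Rmult_le_pos; [exact: pos_INR | exact: pow_le] | lra].
  have h2 : 0 <= Cmod h ^ 2 by apply: pow2_ge_0.
  have tl2 : Er * d ^ 2 <= Cmod h ^ 2 * (Cmod z + d) ^ i.
    by apply: Rle_trans tl _; apply: Rmult_le_compat_l => //; lra.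
  have tl3 : Er <= Cmod h ^ 2 / d ^ 2 * (Cmod z + d) ^ i.
    apply: (Rmult_le_reg_r (d ^ 2)) => //; apply: Rle_trans tl2 _.
    by apply: Req_le; field; lra.
  by have := Rmult_le_compat_l _ _ _ (Cmod_ge_0 (a i)) tl3; lra.
apply: Rle_trans bnd _; have h0 := Cmod_ge_0 h.
have -> : Cmod h ^ 2 / d ^ 2 * B = Cmod h * B / d ^ 2 * Cmod h by field; lra.
apply: Rmult_le_compat_r => //.
apply: (Rmult_le_reg_r (d ^ 2)) => //.
have -> : Cmod h * B / d ^ 2 * d ^ 2 = Cmod h * B by field; lra.
have := Rmult_lt_compat_r (B + 1) _ _ ltac:(lra) he.
have -> : e * d ^ 2 / (B + 1) * (B + 1) = e * d ^ 2 by field; lra.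
by nra.
Qed.

Lemma PSum_at0 a rho f : 0 < rho -> PSum a rho f -> f 0 = a 0%N.
Proof.
move=> r0 fP; have [_ f0] := fP (RtoC 0) ltac:(by rewrite Cmod_0).
apply: Cseries_unique f0 _; apply/is_seriesC => e e0; exists 0%N => n _.
have -> : Csum (fun n => a n * RtoC 0 ^ n)%C n = a 0%N.
  elim: n => [|n IHn]; first by rewrite sum_O; Cring.
  by rewrite sum_Sn IHn; Cring.
have -> : (a 0%N - a 0%N = 0)%C by ring.
by rewrite Cmod_0.
Qed.

Lemma PSum_shift a rho f : 0 < rho -> PSum a rho f ->
  exists2 g, PSum (fun n => a n.+1) rho g &
    forall z, Cmod z < rho -> f z = (a 0%N + z * g z)%C.
Proof.
move=> r0 fP; have [|g gP] := @PSum_of_abs (fun n => a n.+1) rho.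
  move=> x [x0 xr]; set y := (x + rho) / 2; have y0 : 0 < y by rewrite /y; lra.
  have := PSum_abs fP (x := y) ltac:(rewrite /y; lra).
  move=> /ex_series_incr_1 /(ex_series_scal (/ y)).
  apply: ex_series_le => n; rewrite [norm _]Rabs_pos_eq; last first.
    by apply: Rmult_le_pos; [exact: Cmod_ge_0 | exact: pow_le].
  rewrite /scal /= /mult /=.
  have -> : / y * (Cmod (a n.+1) * (y * y ^ n)) = Cmod (a n.+1) * y ^ n by field; lra.
  apply: Rmult_le_compat_l; first exact: Cmod_ge_0.
  by apply: pow_incr; rewrite /y; lra.
exists g => // z zr; have [_ fz] := fP z zr; have [_ gz] := gP z zr.
apply: Cseries_unique fz _; apply: is_series_decr_1.
have -> : plus (a 0%N + z * g z)%C (opp (a 0%N * z ^ 0)%C) = (z * g z)%C by Cring.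
by apply: is_series_ext (Cseries_scal (c := z) gz) => n; Cring.
Qed.

Lemma is_derive_continuous f z l : is_derive (K := C_AbsRing) (V := C_NormedModule) f z l ->
  forall e, 0 < e -> exists2 d, 0 < d & forall w, Cmod (w - z) < d -> Cmod (f w - f z) < e.
Proof.
move=> /is_deriveC df e e0; have [d d0 dP] := df 1 ltac:(lra).
have l0 := Cmod_ge_0 l.
have r0 : 0 < e / (2 + Cmod l) by apply: Rdiv_lt_0_compat; lra.
exists (Rmin d (e / (2 + Cmod l))) => [|w wz]; first exact: Rmin_pos.
have wd : Cmod (w - z) < d by apply: Rlt_le_trans wz (Rmin_l _ _).
have we : Cmod (w - z) < e / (2 + Cmod l) by apply: Rlt_le_trans wz (Rmin_r _ _).
have -> : (f w - f z = (f w - f z - (w - z) * l) + (w - z) * l)%C by ring.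
have := dP w wd; have := Cmod_triangle (f w - f z - (w - z) * l) ((w - z) * l).
rewrite Cmod_mult; have := Rmult_lt_compat_r (2 + Cmod l) _ _ ltac:(lra) we.
have -> : e / (2 + Cmod l) * (2 + Cmod l) = e by field; lra.
by have := Cmod_ge_0 (w - z); nra.
Qed.

Lemma punctured_point z d : 0 < d -> exists2 w, Cmod (w - z) < d & w <> z.
Proof.
move=> d0; exists (z + RtoC (d / 2))%C.
  have -> : (z + RtoC (d / 2) - z = RtoC (d / 2))%C by ring.
  by rewrite Cmod_R Rabs_pos_eq; lra.
move=> E; have : RtoC (d / 2) = 0.
  have -> : (RtoC (d / 2) = z + RtoC (d / 2) - z)%C by ring.
  by rewrite E; ring.
by move=> /RtoC_inj; lra.
Qed.

Lemma Cmod_small_eq0 z : (forall e, 0 < e -> Cmod z < e) -> z = 0.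
Proof.
move=> h; apply: Cmod_eq_0; apply: Rle_antisym (Cmod_ge_0 _).
by apply: le_epsilon => e /h; lra.
Qed.

Lemma PSum_head_eq0 a rho f : 0 < rho -> PSum a rho f ->
  locally' (T := C_UniformSpace) (RtoC 0) (fun z => f z = 0) -> a 0%N = 0.
Proof.
move=> r0 fP /locallyC'[d d0 f0].
rewrite -(PSum_at0 r0 fP); apply: Cmod_small_eq0 => e e0.
have [g _ fg] := PSum_derive fP.
have f'0 := fg (RtoC 0) ltac:(by rewrite Cmod_0).
have [r rp rP] := is_derive_continuous f'0 e0.
have [w wr w0] := punctured_point (RtoC 0) (Rmin_pos _ _ d0 rp).
have := rP w (Rlt_le_trans _ _ _ wr (Rmin_r _ _)).
rewrite f0 //; last exact: Rlt_le_trans wr (Rmin_l _ _).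
have -> : (0 - f 0 = - f 0)%C by ring.
by rewrite Cmod_opp.
Qed.

(** Continuity gives the constant coefficient; then f is divided by z. The division loses the value
    at 0, hence the punctured neighbourhood. *)
Lemma PSum_coef_eq0 a rho f : 0 < rho -> PSum a rho f ->
  locally' (T := C_UniformSpace) (RtoC 0) (fun z => f z = 0) -> forall n, a n = 0.
Proof.
move=> r0 fP f0 n; elim: n a f fP f0 => [|n IHn] a f fP f0.
  exact: (PSum_head_eq0 r0 fP f0).
have a0 := PSum_head_eq0 r0 fP f0.
have [g gP fg] := PSum_shift r0 fP.
apply: (IHn (fun n => a n.+1) g gP).
have /locallyC'[d d0 {}f0] := f0.
apply/locallyC'; exists (Rmin d rho) => [|z zd z0]; first exact: Rmin_pos.
have zr : Cmod z < rho.
  have := Rlt_le_trans _ _ _ zd (Rmin_r _ _).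
  by have -> : (z - 0 = z)%C by ring.
have := fg z zr; rewrite f0 //; last exact: Rlt_le_trans zd (Rmin_l _ _).
rewrite a0 Cplus_0_l => E.
have -> : (g z = / z * (z * g z))%C by field.
by rewrite -E Cmult_0_r.
Qed.

Lemma PSum_eq0 a rho f : 0 < rho -> PSum a rho f ->
  locally' (T := C_UniformSpace) (RtoC 0) (fun z => f z = 0) ->
  forall z, Cmod z < rho -> f z = 0.
Proof.
move=> r0 fP f0 z zr; have a0 := PSum_coef_eq0 r0 fP f0.
have [_ fz] := fP z zr; apply: Cseries_unique fz _.
apply/is_seriesC => e e0; exists 0%N => n _.
have -> : Csum (fun n => a n * z ^ n)%C n = RtoC 0.
  by elim: n => [|n IHn]; rewrite ?sum_O ?sum_Sn ?IHn a0; Cring.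
have -> : (0 - 0 = RtoC 0)%C by ring.
by rewrite Cmod_0.
Qed.

Definition has_PS rho f := exists a, PSum a rho f.

Lemma has_PS_ext rho f g : (forall z, Cmod z < rho -> f z = g z) ->
  has_PS rho f -> has_PS rho g.
Proof. by move=> fg [a fP]; exists a; apply: PSum_ext fP. Qed.

Lemma has_PS_plus rho f g : has_PS rho f -> has_PS rho g ->
  has_PS rho (fun z => f z + g z)%C.
Proof.
move=> [a fP] [b gP]; exists (fun n => a n + b n)%C => z zr.
have [f1 f2] := fP z zr; have [g1 g2] := gP z zr; split.
  apply: ex_series_le (ex_series_plus _ _ f1 g1) => n.
  rewrite [norm _]Rabs_pos_eq; last first.
    by apply: Rmult_le_pos; [exact: Cmod_ge_0 | apply/pow_le/Cmod_ge_0].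
  rewrite /plus /= -Rmult_plus_distr_r.
  by apply: Rmult_le_compat_r; [apply/pow_le/Cmod_ge_0 | exact: Cmod_triangle].
by apply: is_series_ext (Cseries_plus f2 g2) => n; Cring.
Qed.

Lemma has_PS_scal rho (c : C) f : has_PS rho f -> has_PS rho (fun z => c * f z)%C.
Proof.
move=> [a fP]; exists (fun n => c * a n)%C => z zr.
have [f1 f2] := fP z zr; split.
  apply: ex_series_ext (ex_series_scal (Cmod c) _ f1) => n.
  by rewrite Cmod_mult /scal /= /mult /= Rmult_assoc.
by apply: is_series_ext (Cseries_scal (c := c) f2) => n; Cring.
Qed.

Lemma has_PS_mulz rho f : has_PS rho f -> has_PS rho (fun z => z * f z)%C.
Proof.
move=> [a fP]; exists (fun n => if n is m.+1 then a m else RtoC 0) => z zr.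
have [f1 f2] := fP z zr; split.
  apply/ex_series_incr_1; apply: ex_series_ext (ex_series_scal (Cmod z) _ f1) => n.
  by rewrite /scal /= /mult /=; ring.
apply: is_series_decr_1.
have -> : plus (z * f z)%C (opp (RtoC 0 * z ^ 0)%C) = (z * f z)%C by Cring.
by apply: is_series_ext (Cseries_scal (c := z) f2) => n; Cring.
Qed.

Lemma has_PS_cst rho c : has_PS rho (fun _ => c).
Proof.
exists (fun n => if n is 0%N then c else RtoC 0) => z zr; split.
  apply/ex_series_incr_1; exists 0; apply/is_seriesR => e e0; exists 0%N => n _.
  have -> : sum_n (fun k => Cmod 0 * Cmod z ^ k.+1) n = 0.
    by elim: n => [|n IHn]; rewrite ?sum_O ?sum_Sn ?IHn Cmod_0 /plus /=; lra.
  by rewrite Rminus_0_r Rabs_R0.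
apply/is_seriesC => e e0; exists 0%N => n _.
have -> : Csum (fun n => (if n is 0%N then c else RtoC 0) * z ^ n)%C n = c.
  by elim: n => [|n IHn]; rewrite ?sum_O ?sum_Sn ?IHn; Cring.
have -> : (c - c = RtoC 0)%C by ring.
by rewrite Cmod_0.
Qed.

Lemma has_PS_poly_mul rho f (p : seq C) : has_PS rho f ->
  has_PS rho (fun z => Cpoly_eval p z * f z)%C.
Proof.
move=> fP; elim: p => [|c p IHp].
  by apply: has_PS_ext (has_PS_cst rho (RtoC 0)) => z _ /=; ring.
apply: has_PS_ext (has_PS_plus (has_PS_scal c fP) (has_PS_mulz IHp)) => z _ /=; ring.
Qed.

(** * Polynomials, derivatives and poles *)

Definition nonzero_poly (p : seq C) := exists i, nth (RtoC 0) p i <> RtoC 0.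

Lemma Cpoly_add (p q : seq C) : exists r : seq C,
  forall z, Cpoly_eval r z = (Cpoly_eval p z + Cpoly_eval q z)%C.
Proof.
elim: p q => [|a p IHp] [|b q].
- by exists [::] => z /=; ring.
- by exists (b :: q) => z /=; ring.
- by exists (a :: p) => z /=; ring.
by have [r rP] := IHp q; exists ((a + b)%C :: r) => z /=; rewrite rP; ring.
Qed.

Lemma Cpoly_scal c (p : seq C) : exists r : seq C,
  forall z, Cpoly_eval r z = (c * Cpoly_eval p z)%C.
Proof.
elim: p => [|a p [r rP]]; first by exists [::] => z /=; ring.
by exists ((c * a)%C :: r) => z /=; rewrite rP; ring.
Qed.

Lemma Cpoly_mul (p q : seq C) : exists r : seq C,
  forall z, Cpoly_eval r z = (Cpoly_eval p z * Cpoly_eval q z)%C.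
Proof.
elim: p => [|a p [r rP]]; first by exists [::] => z /=; ring.
have [s sP] := Cpoly_scal a q; have [t tP] := Cpoly_add s (RtoC 0 :: r).
by exists t => z; rewrite tP sP /= rP; ring.
Qed.

Lemma Cpoly_pow n : exists r : seq C, forall z, Cpoly_eval r z = (z ^ n)%C.
Proof.
elim: n => [|n [r rP]]; first by exists [:: RtoC 1] => z /=; ring.
by exists (RtoC 0 :: r) => z /=; rewrite rP; ring.
Qed.

Lemma Cpoly_eval_eq0 (p : seq C) z : (forall i, nth (RtoC 0) p i = RtoC 0) -> Cpoly_eval p z = 0.
Proof.
elim: p => //= a p IHp p0; rewrite (IHp (fun i => p0 i.+1)).
by have /= -> := p0 0%N; ring.
Qed.

Lemma nonzero_poly_eval (p : seq C) z : Cpoly_eval p z <> 0 -> nonzero_poly p.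
Proof.
move=> pz; apply: contrapT => p0; apply: pz; apply: Cpoly_eval_eq0 => i.
by apply: contrapT => pi; apply: p0; exists i.
Qed.

(** The quotient of [c :: p] by X - a, for any c: its coefficients are the Horner values at a, and c
    enters only the remainder. *)
Fixpoint synthetic_div (p : seq C) (a : C) : seq C :=
  if p is _ :: p' then Cpoly_eval p a :: synthetic_div p' a else [::].

Lemma synthetic_divE c p a z : Cpoly_eval (c :: p) z =
  (Cpoly_eval (c :: p) a + (z - a) * Cpoly_eval (synthetic_div p a) z)%C.
Proof.
elim: p c => [|b p IHp] c; first by rewrite /=; ring.
rewrite -[LHS]/(c + z * Cpoly_eval (b :: p) z)%C (IHp b) /=; ring.
Qed.

Lemma synthetic_div_eq0 p a : (forall i, nth (RtoC 0) (synthetic_div p a) i = RtoC 0) ->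
  forall i, nth (RtoC 0) p i = RtoC 0.
Proof.
elim: p => //= b p IHp sp0.
have p0 := IHp (fun i => sp0 i.+1).
case=> [|i] /=; last exact: p0.
by have := sp0 0%N; rewrite /= (Cpoly_eval_eq0 a p0) => <-; ring.
Qed.

Lemma Cpoly_roots p : nonzero_poly p ->
  exists s : seq C, forall z, Cpoly_eval p z = 0 -> List.In z s.
Proof.
have [n] := ubnP (size p); elim: n p => // n IHn p szp p0.
have [[a pa]|no_root] := pselect (exists a, Cpoly_eval p a = 0); last first.
  by exists [::] => z pz; case: no_root; exists z.
case: p => [|c p] in szp p0 pa *; first by case: p0 => i; rewrite nth_nil.
have szd : size (synthetic_div p a) = size p.
  by elim: p {szp p0 pa} => //= b p ->.
have [||s sP] := IHn (synthetic_div p a); first by rewrite szd.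
  apply: contrapT => d0; case: p0 => i; apply.
  have p0 : forall j, nth (RtoC 0) p j = RtoC 0.
    apply: (synthetic_div_eq0 (a := a)) => j; apply: contrapT => dj.
    by apply: d0; exists j.
  case: i => [|i] /=; last exact: p0.
  by move: pa; rewrite /= (Cpoly_eval_eq0 a p0) => <-; ring.
exists (a :: s) => z pz; have := synthetic_divE c p a z; rewrite pz pa => E.
have [->|za] := pselect (z = a); first by left.
right; apply: sP.
have za0 : (z - a <> 0)%C by move/Cminus_eq0.
have -> : (Cpoly_eval (synthetic_div p a) z =
  / (z - a) * (0 + (z - a) * Cpoly_eval (synthetic_div p a) z))%C by field.
by rewrite -E Cmult_0_r.
Qed.

Lemma Cpoly_neq0_near p z : nonzero_poly p ->
  locally' (T := C_UniformSpace) z (fun w => Cpoly_eval p w <> 0).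
Proof.
move=> /Cpoly_roots[s sP].
suff : locally' (T := C_UniformSpace) z (fun w => ~ List.In w s).
  by apply: filter_imp => w ws pw; apply/ws/sP.
elim: s {sP} => [|a s IHs]; first by apply: filter_forall => w [].
have : locally' (T := C_UniformSpace) z (fun w => w <> a).
  have [<-|za] := pselect (z = a).
    by apply/locallyC'; exists 1; [lra | ].
  apply/locallyC'; exists (Cmod (z - a)) => [|w wz _ wa].
    by apply/Cmod_gt_0 => /Cminus_eq0.
  move: wz; rewrite wa; have -> : (a - z = - (z - a))%C by ring.
  by rewrite Cmod_opp; lra.
move=> /filter_and/(_ IHs); apply: filter_imp => w [wa ws] [aw|]; last exact: ws.
exact/wa/esym.
Qed.

Lemma Cpoly_infinite_roots p (u : nat -> C) : nonzero_poly p -> injective u ->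
  ~ (forall n, Cpoly_eval p (u n) = 0).
Proof.
move=> /Cpoly_roots[s sP] u_inj pu.
have nd : List.NoDup (List.map u (List.seq 0 (length s).+1)).
  by apply: FinFun.Injective_map_NoDup => //; exact: List.seq_NoDup.
have sub : List.incl (List.map u (List.seq 0 (length s).+1)) s.
  by move=> z /List.in_map_iff[n [<- _]]; apply: sP.
have := List.NoDup_incl_length nd sub.
by rewrite List.length_map List.length_seq => /leP; rewrite ltnn.
Qed.

Local Notation Cderive := (is_derive (K := C_AbsRing) (V := C_NormedModule)).
Local Notation Cdiff := (ex_derive (K := C_AbsRing) (V := C_NormedModule)).

Lemma Cderive_unique f z (l m : C) : Cderive f z l -> Cderive f z m -> l = m.
Proof.
move=> /is_deriveC fl /is_deriveC fm; apply: Cminus_eq0; apply: Cmod_small_eq0 => e e0.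
have [d d0 dl] := fl (e / 3) ltac:(lra); have [r r0 rm] := fm (e / 3) ltac:(lra).
have [w wz wnz] := punctured_point z (Rmin_pos _ _ d0 r0).
have h1 := dl w (Rlt_le_trans _ _ _ wz (Rmin_l _ _)).
have h2 := rm w (Rlt_le_trans _ _ _ wz (Rmin_r _ _)).
have h0 : 0 < Cmod (w - z) by apply/Cmod_gt_0 => /Cminus_eq0.
have : Cmod (w - z) * Cmod (l - m) <= 2 * (e / 3) * Cmod (w - z).
  rewrite -Cmod_mult.
  have -> : ((w - z) * (l - m) = (f w - f z - (w - z) * m) - (f w - f z - (w - z) * l))%C by ring.
  by apply: Rle_trans (Cmod_triangle _ _) _; rewrite Cmod_opp; lra.
by nra.
Qed.

Lemma Cderive_plus f g z (l m : C) : Cderive f z l -> Cderive g z m ->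
  Cderive (fun w => f w + g w)%C z (l + m)%C.
Proof. exact: is_derive_plus. Qed.

(** The product and chain rules concern C as a module over itself, a structure other than
    [C_NormedModule]; the estimates defining the derivative coincide. *)
Lemma is_derive_AbsRing f z (l : C) :
  is_derive (K := C_AbsRing) (V := AbsRing_NormedModule C_AbsRing) f z l <-> Cderive f z l.
Proof.
by split=> -[_ df]; (split; first exact: is_linear_scal_l) => x lim_x e; exact: df.
Qed.

Lemma Cderive_mult f g z (l m : C) : Cderive f z l -> Cderive g z m ->
  Cderive (fun w => f w * g w)%C z (l * g z + f z * m)%C.
Proof.
move=> /is_derive_AbsRing fl /is_derive_AbsRing gm; apply/is_derive_AbsRing.
by apply: (is_derive_mult (K := C_AbsRing)) fl gm _ => x y; exact: Cmult_comm.
Qed.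

Lemma Cderive_cst (c : C) z : Cderive (fun _ => c) z (RtoC 0).
Proof. exact: is_derive_const. Qed.

Lemma Cderive_id z : Cderive (fun w => w) z (RtoC 1).
Proof. apply/is_derive_AbsRing; exact: is_derive_id. Qed.

Lemma Cderive_inv z : z <> 0 -> Cderive Cinv z (- / (z * z))%C.
Proof.
move=> z0; apply/is_deriveC => e e0; have a0 : 0 < Cmod z by apply/Cmod_gt_0.
set a := Cmod z in a0.
have a3 : 0 < e * a ^ 3 / 2 by apply: Rdiv_lt_0_compat; [apply: Rmult_lt_0_compat => //; apply: pow_lt | lra].
(* Within a/2 of z one has 1/|w| <= 2/a, so the error is at most 2 |w - z|^2 / a^3; the second bound
   makes this at most e |w - z|. *)
exists (Rmin (a / 2) (e * a ^ 3 / 2)) => [|w wz]; first by apply: Rmin_pos => //; lra.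
have h1 := Rlt_le_trans _ _ _ wz (Rmin_l _ _).
have h2 := Rlt_le_trans _ _ _ wz (Rmin_r _ _).
have wa : a / 2 < Cmod w.
  have := Cmod_triangle w (z - w); have -> : (w + (z - w) = z)%C by ring.
  have -> : (z - w = - (w - z))%C by ring.
  by rewrite Cmod_opp -/a; lra.
have w0 : w <> 0 by move=> E; move: wa; rewrite E Cmod_0; lra.
have -> : (/ w - / z - (w - z) * - / (z * z) = (w - z) * (w - z) * (/ w * / z * / z))%C.
  by field.
rewrite !Cmod_mult !Cmod_inv // -/a; set h := Cmod (w - z) in h1 h2 *.
have h0 : 0 <= h := Cmod_ge_0 _.
have iw : / Cmod w <= 2 / a.
  have -> : 2 / a = / (a / 2) by field; lra.
  by apply: Rinv_le_contravar; lra.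
have ia : 0 < / a by apply: Rinv_0_lt_compat.
have : / Cmod w * / a * / a <= 2 / a * / a * / a.
  by apply: Rmult_le_compat_r; [lra | apply: Rmult_le_compat_r; lra].
have -> : 2 / a * / a * / a = 2 / a ^ 3 by field; lra.
move=> h3; have h4 : h * (2 / a ^ 3) <= e.
  have -> : e = e * a ^ 3 / 2 * (2 / a ^ 3) by field; lra.
  apply: Rmult_le_compat_r; last lra.
  by apply: Rdiv_le_0_compat; [lra | apply: pow_lt].
have := Rmult_le_compat_l (h * h) _ _ ltac:(nra) h3.
have := Rmult_le_compat_l h _ _ h0 h4.
by nra.
Qed.

Lemma Cdiff_inv f z : Cdiff f z -> f z <> 0 -> Cdiff (fun w => / f w)%C z.
Proof.
move=> [l /is_derive_AbsRing fl] fz; exists (l * (- / (f z * f z)))%C.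
exact: (is_derive_comp (V := C_NormedModule) Cinv f z _ _ (Cderive_inv fz) fl).
Qed.

Lemma Cdiff_plus f g z : Cdiff f z -> Cdiff g z -> Cdiff (fun w => f w + g w)%C z.
Proof. by move=> [l fl] [m gm]; exists (l + m)%C; exact: Cderive_plus. Qed.

Lemma Cdiff_mult f g z : Cdiff f z -> Cdiff g z -> Cdiff (fun w => f w * g w)%C z.
Proof. by move=> [l fl] [m gm]; exists (l * g z + f z * m)%C; exact: Cderive_mult. Qed.

Lemma Cpoly_derive (p : seq C) : exists q : seq C, forall z, Cderive (Cpoly_eval p) z (Cpoly_eval q z).
Proof.
elim: p => [|a p [q qP]]; first by exists [::] => z; exact: Cderive_cst.
have [r rP] := Cpoly_add p (RtoC 0 :: q); exists r => z.
have := Cderive_plus (Cderive_cst a z) (Cderive_mult (Cderive_id z) (qP z)).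
by have -> : (RtoC 0 + (1 * Cpoly_eval p z + z * Cpoly_eval q z) = Cpoly_eval r z)%C by rewrite rP /=; ring.
Qed.

Lemma Cdiff_poly (p : seq C) z : Cdiff (Cpoly_eval p) z.
Proof. by have [q qP] := Cpoly_derive p; exists (Cpoly_eval q z). Qed.

Lemma holomorphic_at_plus f g z : holomorphic_at f z -> holomorphic_at g z ->
  holomorphic_at (fun w => f w + g w)%C z.
Proof.
by move=> fz gz; apply: filter_imp (filter_and _ _ fz gz) => w [fw gw]; exact: Cdiff_plus.
Qed.

Lemma Cpoly_neq0_nbhs p z : Cpoly_eval p z <> 0 ->
  locally (T := C_UniformSpace) z (fun w => Cpoly_eval p w <> 0).
Proof.
move=> pz; have /locallyC'[d d0 pd] := Cpoly_neq0_near z (nonzero_poly_eval pz).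
apply/locallyC; exists d => // w wz.
by have [->|wnz] := pselect (w = z); [ | exact: pd].
Qed.

Lemma holomorphic_at_ratio p q z : Cpoly_eval q z <> 0 ->
  holomorphic_at (fun w => Cpoly_eval p w / Cpoly_eval q w)%C z.
Proof.
move=> /Cpoly_neq0_nbhs; apply: filter_imp => w qw.
by apply: Cdiff_mult; [exact: Cdiff_poly | apply: Cdiff_inv => //; exact: Cdiff_poly].
Qed.

Lemma holomorphic_at_ext f g z : (forall w, f w = g w) -> holomorphic_at f z -> holomorphic_at g z.
Proof. by move=> fg; apply: filter_imp => w; apply: ex_derive_ext. Qed.

Lemma PSum_holomorphic a rho f z : PSum a rho f -> Cmod z < rho -> holomorphic_at f z.
Proof.
move=> fP zr; have [g _ gP] := PSum_derive fP.
apply/locallyC; exists (rho - Cmod z) => [|w wz]; first lra.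
exists (g w); apply: gP.
have := Cmod_triangle z (w - z); have -> : (z + (w - z) = w)%C by ring.
lra.
Qed.

Lemma holomorphic_at_bounded f z : holomorphic_at f z ->
  locally (T := C_UniformSpace) z (fun w => Cmod (f w) < Cmod (f z) + 1).
Proof.
move=> /locally_singleton[l fl].
have [d d0 dP] := is_derive_continuous fl (e := 1) ltac:(lra).
apply/locallyC; exists d => // w wz; have := dP w wz.
have := Cmod_triangle (f w - f z) (f z); have -> : (f w - f z + f z = f w)%C by ring.
lra.
Qed.

Lemma locally_locally' z (P : C -> Prop) :
  locally (T := C_UniformSpace) z P -> locally' (T := C_UniformSpace) z P.
Proof. by apply: filter_imp. Qed.

Lemma is_poleP f z : is_pole f z <->
  locally' (T := C_UniformSpace) z (fun w => Cdiff f w) /\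
  forall M : R, locally' (T := C_UniformSpace) z (fun w => M < Cmod (f w)).
Proof.
split=> -[df lim]; split=> //.
  by move=> M; apply: lim; exists M.
by move=> P [M MP]; apply: filter_imp (lim M) => w; exact: MP.
Qed.

Lemma is_pole_ext f g z : (forall w, f w = g w) -> is_pole f z -> is_pole g z.
Proof.
move=> fg /is_poleP[df lim]; apply/is_poleP; split.
  by apply: filter_imp df => w; apply: ex_derive_ext.
by move=> M; apply: filter_imp (lim M) => w; rewrite fg.
Qed.

Lemma is_pole_plus f g z : is_pole f z -> holomorphic_at g z ->
  is_pole (fun w => f w + g w)%C z.
Proof.
move=> /is_poleP[df lim] gz; apply/is_poleP; split.
  apply: filter_imp (filter_and _ _ df (locally_locally' gz)) => w [fw gw].
  exact: Cdiff_plus.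
move=> M; have gb := locally_locally' (holomorphic_at_bounded gz).
apply: filter_imp (filter_and _ _ (lim (M + Cmod (g z) + 1)) gb) => w [fw gw].
have := Cmod_triangle (f w + g w) (- g w); rewrite Cmod_opp.
have -> : (f w + g w + - g w = f w)%C by ring.
lra.
Qed.

(** * Lambert sums *)

Fixpoint lambert_head Q D z : C :=
  if D is D'.+1 then (lambert_head Q D' z + lambert Q D' z)%C else RtoC 0.

Lemma Cseries_delta j (c : C) : Cseries (fun i => if i == j then c else RtoC 0) c.
Proof.
apply/is_seriesC => e e0; exists j => n jn.
have -> : Csum (fun i => if i == j then c else RtoC 0) n = c.
  have small m : (m < j)%N -> Csum (fun i => if i == j then c else RtoC 0) m = RtoC 0.
    elim: m => [|m IHm] mj; first by rewrite sum_O eq_sym (gtn_eqF mj).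
    by rewrite sum_Sn IHm 1?ltnW // (ltn_eqF mj); Cring.
  rewrite -(subnKC jn); elim: (n - j)%N => [|m IHm].
    rewrite addn0; case: (j) small => [|j'] small; first by rewrite sum_O eqxx.
    by rewrite sum_Sn small // eqxx; Cring.
  by rewrite addnS sum_Sn IHm gtn_eqF ?ltnS ?leq_addr //; Cring.
have -> : (c - c = RtoC 0)%C by ring.
by rewrite Cmod_0.
Qed.

Lemma lambert_head_series Q D z (T : C) :
  Cseries (fun i => if (i < D)%N then RtoC 0 else lambert Q i z) T ->
  Cseries (fun i => lambert Q i z) (lambert_head Q D z + T)%C.
Proof.
elim: D T => [|D IHD] T TP; first by rewrite /= Cplus_0_l; exact: TP.
rewrite [lambert_head _ _ _]/= -Cplus_assoc; apply: IHD.
apply: is_series_ext (Cseries_plus (@Cseries_delta D (lambert Q D z)) TP) => i.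
by rewrite ltnS leq_eqVlt; case: ltngtP => [_|_|->]; Cring.
Qed.

Lemma pow_tail_small Q x : 0 <= x < 1 ->
  exists N, forall D, (N <= D)%N -> Rabs Q * x ^ D.+1 < 1.
Proof.
move=> [x0 x1]; have Q0 := Rabs_pos Q.
have r0 : 0 < / (Rabs Q + 1) by apply: Rinv_0_lt_compat; lra.
have [N HN] := pow_lt_1_zero x ltac:(rewrite Rabs_pos_eq //) _ r0.
exists N => D ND; have := HN D.+1 ltac:(by apply/leP; exact: leqW).
rewrite Rabs_pos_eq; last exact: pow_le.
move/(Rmult_lt_compat_r (Rabs Q + 1) _ _ ltac:(lra)).
rewrite Rinv_l; last lra.
by have := pow_le x D.+1 x0; nra.
Qed.

(** The number of terms split off depends on z. The series has a sum even at a pole, where the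
    singular term is just one finite default value. *)
Lemma lambert_sum_exists Q : exists S : C -> C,
  forall z, Cmod z < 1 -> Cseries (fun i => lambert Q i z) (S z).
Proof.
have /boolp.choice[S SP] : forall z, exists s, Cmod z < 1 -> Cseries (fun i => lambert Q i z) s.
  move=> z; have [z1|z1] := Rlt_dec (Cmod z) 1; last by exists (RtoC 0).
  have [N HN] := pow_tail_small Q (conj (Cmod_ge_0 z) z1).
  have [T TP _] := lambert_tail (Rle_refl _) z1 (HN N (leqnn N)).
  by exists (lambert_head Q N z + T)%C => _; exact: lambert_head_series.
by exists S.
Qed.

Lemma lambert_split Q S rho D : 0 < rho < 1 -> Rabs Q * rho ^ D.+1 < 1 ->
  (forall z, Cmod z < 1 -> Cseries (fun i => lambert Q i z) (S z)) ->
  PSum (fun n => RtoC (tail_coef Q D n)) rho (fun z => S z - lambert_head Q D z)%C.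
Proof.
move=> [r0 r1] Qr SP z zr; have z0 := Cmod_ge_0 z.
have [T TP TC] := lambert_tail (Rlt_le _ _ zr) r1 Qr.
have -> : (S z - lambert_head Q D z = T)%C.
  rewrite (Cseries_unique (SP z ltac:(lra)) (lambert_head_series TP)); ring.
split=> //; have [||] := @tail_coef_ex_series Q D (Cmod z); first lra.
  apply: Rle_lt_trans Qr; apply: Rmult_le_compat_l; first exact: Rabs_pos.
  by apply: pow_incr; lra.
by move=> s sP; exists s; apply: is_series_ext sP => n; rewrite Cmod_R.
Qed.

Lemma one_minus_poly (c : C) n : exists2 p : seq C, nonzero_poly p &
  forall z, Cpoly_eval p z = (1 - c * z ^ n.+1)%C.
Proof.
have [r rP] := Cpoly_pow n.+1; have [s sP] := Cpoly_scal (- c) r.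
have [p pP] := Cpoly_add [:: RtoC 1] s.
have pE z : Cpoly_eval p z = (1 - c * z ^ n.+1)%C by rewrite pP sP rP /=; ring.
exists p => //; apply: (@nonzero_poly_eval p (RtoC 0)); rewrite pE.
have -> : (1 - c * 0 ^ n.+1 = RtoC 1)%C by rewrite /=; ring.
by move/RtoC_inj; lra.
Qed.

Lemma lambert_ratio Q i : exists p q : seq C,
  [/\ forall z, Cpoly_eval q z = (1 - RtoC Q * z ^ i.+1)%C,
      Cpoly_eval q 0 <> 0 &
      forall z, Cpoly_eval q z <> 0 -> (Cpoly_eval q z * lambert Q i z = Cpoly_eval p z)%C].
Proof.
have [q _ qE] := one_minus_poly (RtoC Q) i.
have [r rP] := Cpoly_pow i.+1.
have [p pP] := Cpoly_scal (RtoC (INR (totient i.+1)) * RtoC Q)%C r.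
exists p, q; split=> //.
  rewrite qE; have -> : (1 - RtoC Q * 0 ^ i.+1 = RtoC 1)%C by rewrite /=; ring.
  by move/RtoC_inj; lra.
move=> z qz; rewrite pP rP /lambert -qE -Cmult_assoc.
have -> : (RtoC Q * z ^ i.+1 = 1 - Cpoly_eval q z)%C by rewrite qE; ring.
by field.
Qed.

Lemma lambert_holomorphic Q i z : (1 - RtoC Q * z ^ i.+1)%C <> 0 ->
  holomorphic_at (lambert Q i) z.
Proof.
have [q _ qE] := one_minus_poly (RtoC Q) i; rewrite -qE => qz.
have h := holomorphic_at_ratio [:: RtoC (INR (totient i.+1))] qz.
have h2 : holomorphic_at (fun _ => - RtoC (INR (totient i.+1)))%C z.
  by apply: filter_forall => w; eexists; exact: Cderive_cst.
apply: holomorphic_at_ext (holomorphic_at_plus h h2) => w.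
by rewrite /lambert -qE /= /Cdiv; ring.
Qed.

Lemma lambert_pole Q i z : (1 - RtoC Q * z ^ i.+1)%C = 0 -> is_pole (lambert Q i) z.
Proof.
move=> qz0; have [q q0 qE] := one_minus_poly (RtoC Q) i.
have qnz := Cpoly_neq0_near z q0.
apply/is_poleP; split.
  apply: filter_imp qnz => w; rewrite qE => /lambert_holomorphic.
  exact: locally_singleton.
move=> M; have [l ql] := Cdiff_poly q z.
(* With u the denominator, |u| < 1/(|M| + 2) gives |1/u - 1| > |M| + 1, and phi >= 1 does not
   decrease it. *)
have e0 : 0 < / (Rabs M + 2) by apply: Rinv_0_lt_compat; have := Rabs_pos M; lra.
have [d d0 dP] := is_derive_continuous ql e0.
have qsmall : locally' (T := C_UniformSpace) z (fun w => Cmod (Cpoly_eval q w) < / (Rabs M + 2)).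
  apply/locallyC'; exists d => // w wz _; have := dP w wz.
  rewrite [Cpoly_eval q z]qE qz0.
  by have -> : (Cpoly_eval q w - 0 = Cpoly_eval q w)%C by ring.
apply: filter_imp (filter_and _ _ qnz qsmall) => w [qw qws].
rewrite /lambert -qE; set u := Cpoly_eval q w in qw qws *.
have t1 : 1 <= INR (totient i.+1).
  by rewrite -[1]/(INR 1); apply/le_INR/leP; rewrite totient_gt0.
have u0 : 0 < Cmod u by apply/Cmod_gt_0.
have M0 := Rabs_pos M.
have inv : Rabs M + 2 < / Cmod u.
  rewrite -(Rinv_inv (Rabs M + 2)); apply: Rinv_lt_contravar => //.
  exact: Rmult_lt_0_compat.
rewrite Cmod_mult Cmod_R Rabs_pos_eq; last lra.
have : / Cmod u - 1 <= Cmod (1 / u - 1).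
  have := Cmod_triangle (1 / u - 1) 1; have -> : (1 / u - 1 + 1 = / u)%C by field.
  by rewrite Cmod_inv // Cmod_1; lra.
have := Rle_abs M; nra.
Qed.

(** Two such equations with a < b would give z^(b-a) = 1, impossible inside the disc. So the poles
    of distinct terms never cancel. *)
Lemma lambert_pole_unique Q i j z : Cmod z < 1 ->
  (1 - RtoC Q * z ^ i.+1)%C = 0 -> (1 - RtoC Q * z ^ j.+1)%C = 0 -> i = j.
Proof.
have wlog_lt a b : (a < b)%N -> Cmod z < 1 -> (1 - RtoC Q * z ^ a.+1)%C = 0 ->
    (1 - RtoC Q * z ^ b.+1)%C = 0 -> False.
  move=> ab z1 /Cminus_eq0 Ea /Cminus_eq0 Eb.
  have E : (z ^ (b - a) = 1)%C.
    rewrite Eb; have -> : b.+1 = (b - a + a.+1)%coq_nat by rewrite plusE addnS subnK // ltnW.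
    by rewrite Cpow_add_r Cmult_comm -Cmult_assoc (Cmult_comm _ (RtoC Q)) -Ea Cmult_1_r.
  have := congr1 Cmod E; rewrite Cmod_pow Cmod_1.
  have ba : (0 < b - a)%N by rewrite subn_gt0.
  have := pow_lt_1_compat (Cmod z) (b - a) (conj (Cmod_ge_0 z) z1) ltac:(by apply/ltP).
  lra.
move=> z1 zi zj; case: (ltngtP i j) => // h; first by case: (wlog_lt _ _ h z1 zi zj).
by case: (wlog_lt _ _ h z1 zj zi).
Qed.

Lemma lambert_head_holomorphic Q D z :
  (forall i, (i < D)%N -> (1 - RtoC Q * z ^ i.+1)%C <> 0) ->
  holomorphic_at (lambert_head Q D) z.
Proof.
elim: D => [|D IHD] nz.
  by apply: filter_forall => w; eexists; exact: Cderive_cst.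
apply: holomorphic_at_plus; last exact/lambert_holomorphic/nz.
by apply: IHD => i iD; apply: nz; exact: leqW.
Qed.

Lemma lambert_head_pole Q D i z : Cmod z < 1 -> (i < D)%N ->
  (1 - RtoC Q * z ^ i.+1)%C = 0 -> is_pole (lambert_head Q D) z.
Proof.
move=> z1 + zi; have others j : j <> i -> (1 - RtoC Q * z ^ j.+1)%C <> 0.
  by move=> ji zj; apply: ji; exact: lambert_pole_unique zj zi.
elim: D => // D IHD; rewrite ltnS leq_eqVlt => /orP[/eqP<-|iD].
  have h := @is_pole_plus (lambert Q i) (lambert_head Q i) z (lambert_pole zi).
  apply: is_pole_ext (h _) => [w|]; first by rewrite /= Cplus_comm.
  by apply: lambert_head_holomorphic => j ji; apply: others => E; move: ji; rewrite E ltnn.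
apply: is_pole_plus; first exact: IHD.
by apply: lambert_holomorphic; apply: others => E; move: iD; rewrite E ltnn.
Qed.

Section LambertSum.

Variables (Q : R) (S : C -> C) (r : C -> C).

Hypothesis SP : forall z, Cmod z < 1 -> Cseries (fun i => lambert Q i z) (S z).
Hypothesis r_hol : forall z, Cmod z < 1 -> holomorphic_at r z.

(** The parameter N lets a chosen singular term be forced into the finite head; rho is midway
    between |z| and 1. *)
Lemma lambert_sum_split z N : Cmod z < 1 -> exists D rho T, [/\ (N <= D)%N,
  Cmod z < rho, rho < 1, has_PS rho T & forall w, S w = (lambert_head Q D w + T w)%C].
Proof.
move=> z1; have z0 := Cmod_ge_0 z; pose rho := (Cmod z + 1) / 2.
have [M HM] := pow_tail_small Q (x := rho) ltac:(rewrite /rho; lra).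
have sp := lambert_split (rho := rho) ltac:(rewrite /rho; lra) (HM _ (leq_maxr N M)) SP.
exists (maxn N M), rho, (fun w => S w - lambert_head Q (maxn N M) w)%C; split.
- exact: leq_maxl.
- by rewrite /rho; lra.
- by rewrite /rho; lra.
- by exists (fun n => RtoC (tail_coef Q (maxn N M) n)).
- by move=> w; ring.
Qed.

Lemma lambert_sum_holomorphic z : Cmod z < 1 ->
  (forall i, (1 - RtoC Q * z ^ i.+1)%C <> 0) -> holomorphic_at (fun w => r w + S w)%C z.
Proof.
move=> z1 nz; have [D [rho [T [_ zr r1 [a TP] ST]]]] := lambert_sum_split 0 z1.
apply: holomorphic_at_plus; first exact: r_hol.
apply: (@holomorphic_at_ext (fun w => lambert_head Q D w + T w)%C) => [w|]; first by rewrite ST.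
apply: holomorphic_at_plus; last exact: PSum_holomorphic TP zr.
by apply: lambert_head_holomorphic => i _.
Qed.

Lemma lambert_sum_pole i z : Cmod z < 1 -> (1 - RtoC Q * z ^ i.+1)%C = 0 ->
  is_pole (fun w => r w + S w)%C z.
Proof.
move=> z1 zi; have [D [rho [T [iD zr r1 [a TP] ST]]]] := lambert_sum_split i.+1 z1.
apply: (@is_pole_ext (fun w => lambert_head Q D w + (r w + T w))%C) => [w|].
  by rewrite ST; ring.
apply: is_pole_plus; first exact: lambert_head_pole zi.
by apply: holomorphic_at_plus; [exact: r_hol | exact: PSum_holomorphic TP zr].
Qed.

(** Unlike [rational_near0], the identity holds wherever the denominator is nonzero, so it can be
    used near a pole far from 0. *)
Definition rational_fun f := exists p q : seq C, Cpoly_eval q 0 <> 0 /\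
  forall z, Cpoly_eval q z <> 0 -> (Cpoly_eval q z * f z = Cpoly_eval p z)%C.

Lemma rational_fun_plus f g : rational_fun f -> rational_fun g ->
  rational_fun (fun z => f z + g z)%C.
Proof.
move=> [p1 [q1 [q10 E1]]] [p2 [q2 [q20 E2]]].
have [q qE] := Cpoly_mul q1 q2.
have [a aE] := Cpoly_mul p1 q2; have [b bE] := Cpoly_mul p2 q1.
have [p pE] := Cpoly_add a b.
exists p, q; split=> [|z]; first by rewrite qE; exact: Cmult_neq_0.
rewrite qE pE aE bE => q0.
have n1 : Cpoly_eval q1 z <> 0 by move=> E; apply: q0; rewrite E Cmult_0_l.
have n2 : Cpoly_eval q2 z <> 0 by move=> E; apply: q0; rewrite E Cmult_0_r.
by rewrite -E1 // -E2 //; ring.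
Qed.

Lemma rational_fun_ratio (p q : seq C) : Cpoly_eval q 0 <> 0 ->
  rational_fun (fun z => Cpoly_eval p z / Cpoly_eval q z)%C.
Proof. by move=> q0; exists p, q; split=> // z qz; field. Qed.

Lemma rational_fun_ext f g : (forall z, f z = g z) -> rational_fun f -> rational_fun g.
Proof.
by move=> fg [p [q [q0 E]]]; exists p, q; split=> // z qz; rewrite -fg; exact: E.
Qed.

Lemma rational_fun_lambert_head D : rational_fun (lambert_head Q D).
Proof.
elim: D => [|D IHD].
  exists [::], [:: RtoC 1]; split=> [|z _] /=; last ring.
  have -> : (1 + 0 * 0 = RtoC 1)%C by ring.
  by move/RtoC_inj; lra.
by apply: rational_fun_plus => //; have [p [q [_ q0 E]]] := lambert_ratio Q D; exists p, q.
Qed.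

Hypothesis r_rat : rational_fun r.

(* Up to radius rho > |z|, the sum is a rational function plus a power series,
   so clearing denominators turns q H = p into an identity of power series, which
   extends from 0 to the whole disc of radius rho. *)
Lemma lambert_sum_pole_root i (p q : seq C) z :
  locally' (T := C_UniformSpace) (RtoC 0)
    (fun w => Cpoly_eval q w * (r w + S w) = Cpoly_eval p w)%C ->
  Cmod z < 1 -> (1 - RtoC Q * z ^ i.+1)%C = 0 -> Cpoly_eval q z = 0.
Proof.
move=> qp z1 zi; have [D [rho [T [iD zr r1 TP ST]]]] := lambert_sum_split i.+1 z1.
have [A [P [P0 PA]]] := rational_fun_plus r_rat (rational_fun_lambert_head D).
have [qP qPE] := Cpoly_mul q P; have [qA qAE] := Cpoly_mul q A.
have [pP pPE] := Cpoly_mul p P.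
have r0 : 0 < rho by have := Cmod_ge_0 z; lra.
have [a GP] : has_PS rho (fun w => Cpoly_eval qP w * T w + (Cpoly_eval qA w * 1 + -1 * (Cpoly_eval pP w * 1)))%C.
  apply: has_PS_plus; first exact: has_PS_poly_mul.
  by apply: has_PS_plus; [|apply: has_PS_scal]; apply: has_PS_poly_mul; exact: has_PS_cst.
have Pnz : forall x, locally' (T := C_UniformSpace) x (fun w => Cpoly_eval P w <> 0).
  by move=> x; apply: Cpoly_neq0_near; exact: nonzero_poly_eval P0.
have G0 := PSum_eq0 r0 GP.
have qH w : Cmod w < rho -> Cpoly_eval P w <> 0 ->
    (Cpoly_eval q w * (r w + S w) = Cpoly_eval p w)%C.
  move=> wr Pw; apply: Cminus_eq0.
  have := G0 _ w wr; rewrite qPE qAE pPE -(PA w Pw) => G0w.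
  have E : (Cpoly_eval P w * (Cpoly_eval q w * (r w + S w) - Cpoly_eval p w) = 0)%C.
    rewrite ST -G0w; first ring.
    apply: filter_imp (filter_and _ _ qp (Pnz (RtoC 0))) => x [qpx Px].
    by rewrite qPE qAE pPE -(PA x Px) -qpx ST; ring.
  have -> : (Cpoly_eval q w * (r w + S w) - Cpoly_eval p w =
    / Cpoly_eval P w * (Cpoly_eval P w * (Cpoly_eval q w * (r w + S w) - Cpoly_eval p w)))%C by field.
  by rewrite E Cmult_0_r.
apply: contrapT => qz; have qz0 : 0 < Cmod (Cpoly_eval q z) by apply/Cmod_gt_0.
have /is_poleP[_ Hlim] := lambert_sum_pole z1 zi.
have [lq dq] := Cdiff_poly q z; have [lp dp] := Cdiff_poly p z.
have [dlq dq0 cq] := is_derive_continuous dq (e := Cmod (Cpoly_eval q z) / 2) ltac:(lra).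
have [dlp dp0 cp] := is_derive_continuous dp (e := 1) ltac:(lra).
(* Near z, |q| exceeds |q(z)|/2 and |p| stays below |p(z)| + 1, so |H| > B contradicts q H = p. *)
set B := (Cmod (Cpoly_eval p z) + 1) / (Cmod (Cpoly_eval q z) / 2).
have near_z : locally' (T := C_UniformSpace) z
    (fun w => B < Cmod (r w + S w) /\ Cpoly_eval P w <> 0).
  exact: filter_and (Hlim B) (Pnz z).
have /locallyC'[d d0 dP] := near_z.
have [w wz wnz] := punctured_point z (Rmin_pos _ _ (Rmin_pos _ _ d0 (ltac:(lra) : 0 < rho - Cmod z)) (Rmin_pos _ _ dq0 dp0)).
have [wd wr] := Rmin_Rgt_l _ _ _ (Rlt_le_trans _ _ _ wz (Rmin_l _ _)).
have [wq wp] := Rmin_Rgt_l _ _ _ (Rlt_le_trans _ _ _ wz (Rmin_r _ _)).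
have [HB Pw] := dP w wd wnz.
have wrho : Cmod w < rho.
  by have := Cmod_triangle z (w - z); have -> : (z + (w - z) = w)%C; [ring | lra].
have := congr1 Cmod (qH w wrho Pw); rewrite Cmod_mult => E.
have h1 := cq w wq; have h2 := cp w wp.
have h3 := Cmod_triangle (Cpoly_eval p w - Cpoly_eval p z) (Cpoly_eval p z).
have h4 := Cmod_triangle (Cpoly_eval q w) (- (Cpoly_eval q w - Cpoly_eval q z)).
have Ep : (Cpoly_eval p w - Cpoly_eval p z + Cpoly_eval p z = Cpoly_eval p w)%C by ring.
have Eq : (Cpoly_eval q w + - (Cpoly_eval q w - Cpoly_eval q z) = Cpoly_eval q z)%C by ring.
rewrite Ep in h3; rewrite Eq Cmod_opp in h4.
have h5 : (Cmod (Cpoly_eval q z) / 2) * B < Cmod (Cpoly_eval q w) * Cmod (r w + S w).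
  apply: (Rle_lt_trans _ (Cmod (Cpoly_eval q w) * B)).
    apply: Rmult_le_compat_r; last lra.
    by apply: Rdiv_le_0_compat; [have := Cmod_ge_0 (Cpoly_eval p z); lra | lra].
  by apply: Rmult_lt_compat_l; lra.
have h6 : (Cmod (Cpoly_eval q z) / 2) * B = Cmod (Cpoly_eval p z) + 1 by rewrite /B; field; lra.
lra.
Qed.

Hypothesis Q1 : 1 < Q.

(** The positive real root Q^(-1/d) for d = i+1; one pole per term is enough for infinitely many. *)
Definition lambert_pole_pt (i : nat) : C := RtoC (exp (- ln Q / INR i.+1)).

Lemma lambert_pole_ptP i :
  Cmod (lambert_pole_pt i) < 1 /\ (1 - RtoC Q * lambert_pole_pt i ^ i.+1)%C = 0.
Proof.
have lnQ : 0 < ln Q by rewrite -ln_1; apply: ln_increasing; lra.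
have i0 : 0 < INR i.+1 by apply: lt_0_INR; apply/ltP.
split.
  rewrite Cmod_R Rabs_pos_eq; last exact/Rlt_le/exp_pos.
  rewrite -exp_0; apply: exp_increasing.
  by have := Rdiv_lt_0_compat _ _ lnQ i0; rewrite /Rdiv; lra.
rewrite -RtoC_pow.
have -> : exp (- ln Q / INR i.+1) ^ i.+1 = / Q.
  rewrite -Rpower_pow; last exact: exp_pos.
  rewrite /Rpower ln_exp; have -> : INR i.+1 * (- ln Q / INR i.+1) = - ln Q by field; lra.
  by rewrite exp_Ropp exp_ln; lra.
by rewrite -RtoC_mult Rinv_r; [ring | lra].
Qed.

Lemma lambert_pole_pt_inj : injective lambert_pole_pt.
Proof.
move=> i j E; have [z1 zi] := lambert_pole_ptP i; have [_ zj] := lambert_pole_ptP j.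
by rewrite -E in zj; exact: lambert_pole_unique zi zj.
Qed.

Lemma lambert_sum_not_rational (p q : seq C) : nonzero_poly q ->
  ~ locally' (T := C_UniformSpace) (RtoC 0)
    (fun w => Cpoly_eval q w * (r w + S w) = Cpoly_eval p w)%C.
Proof.
move=> q0 qp; apply: (Cpoly_infinite_roots q0 lambert_pole_pt_inj) => n.
by have [z1 zn] := lambert_pole_ptP n; exact: lambert_sum_pole_root qp z1 zn.
Qed.

Lemma lambert_sum_infinite_poles :
  infinite_set [set z : C | unit_disc z /\ is_pole (fun w => r w + S w)%C z]%classic.
Proof.
apply: (@sub_infinite_set _ (range lambert_pole_pt)).
  move=> _ [n _ <-]; have [z1 zn] := lambert_pole_ptP n.
  by split=> //; exact: lambert_sum_pole zn.
by rewrite (eq_finite_set (inj_card_eq (in2W lambert_pole_pt_inj))); exact: infinite_nat.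
Qed.

End LambertSum.

(** * Generating functions of conjugacy growth *)

(** The sum s of (n+1) z^n satisfies s - z s = 1/(1-z), and the series in question sums to z s. *)
Lemma Cseries_INR_pow z : Cmod z < 1 ->
  Cseries (fun n => RtoC (INR n) * z ^ n)%C (z / (1 - z) ^ 2)%C.
Proof.
move=> z1; have z0 := Cmod_ge_0 z.
have [|s sP] := @Cseries_ex_abs (fun n => RtoC (INR n.+1) * z ^ n)%C _ _ (ex_series_INR_pow (conj z0 z1)).
  by move=> n; rewrite Cmod_mult Cmod_R Cmod_pow Rabs_pos_eq; [apply: Rle_refl | exact: pos_INR].
have sh : Cseries (fun n => RtoC (INR n) * z ^ n)%C (z * s)%C.
  apply: is_series_decr_1.
  have -> : plus (z * s)%C (opp (RtoC (INR 0) * z ^ 0)%C) = (z * s)%C by Cring.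
  by apply: is_series_ext (Cseries_scal (c := z) sP) => n; Cring.
have nz : (1 - z <> 0)%C by move=> /Cminus_eq0 E; apply: (Cmod_lt1_neq1 z1).
have geo := Cseries_plus sP (Cseries_scal (c := (-1)%C) sh).
have E : (s + -1 * (z * s) = 1 / (1 - z))%C.
  apply: Cseries_unique (Cgeom_series z1); apply: is_series_ext geo => n.
  by rewrite S_INR RtoC_plus; Cring.
have -> : (z / (1 - z) ^ 2 = z * s)%C; last exact: sh.
have -> : (s = (s + -1 * (z * s)) / (1 - z))%C by asC; field.
by rewrite E; field.
Qed.

(** Sum of the previous series at z and at -z. *)
Lemma Cseries_INR_alt_pow z : Cmod z < 1 ->
  Cseries (fun n => RtoC (INR n * (1 + (-1) ^ n)) * z ^ n)%C (4 * (z ^ 2 / (1 - z ^ 2) ^ 2))%C.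
Proof.
move=> z1; have nz1 : Cmod (- z) < 1 by rewrite Cmod_opp.
have := Cseries_plus (Cseries_INR_pow z1) (Cseries_INR_pow nz1).
have a0 : (1 - z <> 0)%C by move=> /Cminus_eq0 E; apply: (Cmod_lt1_neq1 z1).
have b0 : (1 + z <> 0)%C.
  have -> : (1 + z = 1 - - z)%C by ring.
  by move=> /Cminus_eq0 E; apply: (Cmod_lt1_neq1 nz1).
have -> : (z / (1 - z) ^ 2 + - z / (1 - - z) ^ 2 = 4 * (z ^ 2 / (1 - z ^ 2) ^ 2))%C.
  have -> : (1 - - z = 1 + z)%C by ring.
  have -> : (1 - z ^ 2 = (1 - z) * (1 + z))%C by ring.
  by field.
apply: is_series_ext => n; rewrite RtoC_mult RtoC_plus RtoC_pow.
have -> : RtoC (-1) = (- RtoC 1)%C by rewrite -RtoC_opp.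
have -> : (- z = - RtoC 1 * z)%C by ring.
rewrite Cpow_mult_l; Cring.
Qed.

Section ConjugacyGrowth.

Variable k : nat.

Local Notation Q := (2 * INR k - 1).

Definition growth_rational z : C :=
  (z / (1 - z) ^ 2 + 2 * (RtoC (INR k) - 1) * (z ^ 2 / (1 - z ^ 2) ^ 2))%C.

Lemma growth_denominators : exists q1 q2 : seq C,
  forall z, Cpoly_eval q1 z = ((1 - z) ^ 2)%C /\ Cpoly_eval q2 z = ((1 - z ^ 2) ^ 2)%C.
Proof.
exists [:: RtoC 1; (- RtoC 2)%C; RtoC 1], [:: RtoC 1; RtoC 0; (- RtoC 2)%C; RtoC 0; RtoC 1] => z.
by split; rewrite /=; ring.
Qed.

Lemma growth_rationalE (q1 q2 : seq C) :
  (forall z, Cpoly_eval q1 z = ((1 - z) ^ 2)%C /\ Cpoly_eval q2 z = ((1 - z ^ 2) ^ 2)%C) ->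
  forall z, (Cpoly_eval [:: RtoC 0; RtoC 1] z / Cpoly_eval q1 z +
    Cpoly_eval [:: RtoC 0; RtoC 0; 2 * (RtoC (INR k) - 1)]%C z / Cpoly_eval q2 z)%C =
    growth_rational z.
Proof. by move=> qE z; have [-> ->] := qE z; rewrite /growth_rational /= /Cdiv; ring. Qed.

Lemma growth_denominators_neq0 z : Cmod z < 1 -> ((1 - z) ^ 2 <> 0)%C /\ ((1 - z ^ 2) ^ 2 <> 0)%C.
Proof.
move=> z1; split; apply: Cpow_nz => /Cminus_eq0 E; first exact: (Cmod_lt1_neq1 z1).
apply: (@Cmod_lt1_neq1 (z ^ 2)%C) => //; rewrite Cmod_pow.
by have := Cmod_ge_0 z; rewrite /=; nra.
Qed.

Lemma growth_rational_holomorphic z : Cmod z < 1 -> holomorphic_at growth_rational z.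
Proof.
move=> /growth_denominators_neq0[n1 n2].
have [q1 [q2 qE]] := growth_denominators; have [E1 E2] := qE z.
apply: holomorphic_at_ext (growth_rationalE qE) _.
by apply: holomorphic_at_plus; apply: holomorphic_at_ratio; rewrite ?E1 ?E2.
Qed.

Lemma growth_rational_rational : rational_fun growth_rational.
Proof.
have [q1 [q2 qE]] := growth_denominators; have [E1 E2] := qE (RtoC 0).
have [n1 n2] := @growth_denominators_neq0 (RtoC 0) ltac:(rewrite Cmod_0; lra).
apply: rational_fun_ext (growth_rationalE qE) _.
by apply: rational_fun_plus; apply: rational_fun_ratio; rewrite ?E1 ?E2.
Qed.

Variable S : C -> C.
Hypothesis SP : forall z, Cmod z < 1 -> Cseries (fun i => lambert Q i z) (S z).

(** Below this radius both |z| and |Q| |z| are less than 1, so no Lambert term is singular and the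
    head is empty. *)
Definition growth_radius := / (Rabs Q + 2).

Lemma growth_radius_bounds : 0 < growth_radius < 1 /\ Rabs Q * growth_radius ^ 1 < 1.
Proof.
rewrite /growth_radius; have Q0 := Rabs_pos Q.
have i0 : 0 < / (Rabs Q + 2) by apply: Rinv_0_lt_compat; lra.
have : / (Rabs Q + 2) * (Rabs Q + 2) = 1 by apply: Rinv_l; lra.
by rewrite /= Rmult_1_r; split; [split | ]; nra.
Qed.

Lemma growth_PSum :
  PSum (fun n => RtoC (INR (n * CC k n)%N)) growth_radius (fun z => growth_rational z + S z)%C.
Proof.
have [rho01 Qr] := growth_radius_bounds.
have HS z : Cmod z < growth_radius ->
    Cseries (fun n => RtoC (INR (n * CC k n)%N) * z ^ n)%C (growth_rational z + S z)%C.
  move=> zr; have z1 : Cmod z < 1 by lra.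
  have [_ s3] := lambert_split rho01 Qr SP zr.
  have := Cseries_plus (Cseries_plus (Cseries_INR_pow z1)
    (Cseries_scal (c := RtoC ((INR k - 1) / 2)) (Cseries_INR_alt_pow z1))) s3.
  have -> : (z / (1 - z) ^ 2 + RtoC ((INR k - 1) / 2) * (4 * (z ^ 2 / (1 - z ^ 2) ^ 2)) +
    (S z - lambert_head Q 0 z) = growth_rational z + S z)%C.
    rewrite Cmult_assoc.
    have -> : (RtoC ((INR k - 1) / 2) * 4 = 2 * (RtoC (INR k) - 1))%C.
      by rewrite -RtoC_mult -RtoC_minus -RtoC_mult; congr RtoC; field.
    by rewrite /growth_rational /=; ring.
  apply: is_series_ext => n.
  by rewrite CC_coef !RtoC_plus (RtoC_mult ((INR k - 1) / 2)) /tail_coef /=; Cring.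
move=> z zr; split; last exact: HS.
(* The coefficients are nonnegative, so convergence at the real point |z| is absolute convergence at
   z. *)
have := HS (RtoC (Cmod z)); rewrite Cmod_R Rabs_pos_eq; last exact: Cmod_ge_0.
move=> /(_ zr)/Cseries_Re sR; eexists; apply: is_series_ext sR => n.
by rewrite -RtoC_pow -RtoC_mult Cmod_R Rabs_pos_eq //; exact: pos_INR.
Qed.

(** Comparison with the previous series: CC(n) <= n CC(n) for n >= 1. *)
Lemma CC_PSum : exists F, PSum (fun n => RtoC (INR (CC k n))) growth_radius F.
Proof.
apply: PSum_of_abs => x x0; apply/ex_series_incr_1.
have /ex_series_incr_1 := PSum_abs growth_PSum x0.
apply: (ex_series_le (V := R_CompleteNormedModule)) => n.
rewrite [norm _]Rabs_pos_eq; last first.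
  by apply: Rmult_le_pos; [exact: Cmod_ge_0 | apply: pow_le; lra].
apply: Rmult_le_compat_r; first by apply: pow_le; lra.
rewrite !Cmod_R !Rabs_pos_eq; [|exact: pos_INR..].
by apply/le_INR/leP; rewrite leq_pmull.
Qed.

Lemma growth_base_gt1 : (1 < k)%N -> 1 < Q.
Proof. by move=> /leP/le_INR; rewrite [INR 2]/=; lra. Qed.

(** Here G = F', and H = z F' because the coefficient of z^n in z F' is n CC(n). Thus G extends
    H(z)/z differentiably across 0. *)
Lemma growth_derive F : PSum (fun n => RtoC (INR (CC k n))) growth_radius F ->
  exists2 G, forall z, Cmod z < growth_radius ->
      Cderive F z (G z) /\ (growth_rational z + S z = z * G z)%C &
    forall z, Cmod z < growth_radius -> Cdiff G z.
Proof.
move=> FP; have [[r0 _] _] := growth_radius_bounds.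
have [G GP dF] := PSum_derive FP.
have [G' G'P HG'] := PSum_shift r0 growth_PSum.
exists G => z zr; last first.
  exact: (locally_singleton _ _ (PSum_holomorphic GP zr)).
split; first exact: dF.
rewrite (HG' z zr) mul0n /=.
have [_ s1] := GP z zr; have [_ s2] := G'P z zr.
have -> : G' z = G z; last ring.
apply: Cseries_unique s2 _.
by apply: is_series_ext s1 => n; rewrite mult_INR RtoC_mult.
Qed.

Lemma locally_growth_radius (P : C -> Prop) :
  (forall z, Cmod z < growth_radius -> P z) -> locally (T := C_UniformSpace) (RtoC 0) P.
Proof.
move=> hP; have [[r0 _] _] := growth_radius_bounds.
apply/locallyC; exists growth_radius => // z zr; apply: hP.
have Ez : (z - 0 = z)%C by ring.
by rewrite Ez in zr.
Qed.

Lemma growth_meromorphic : meromorphic_on unit_disc (fun z => growth_rational z + S z)%C.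
Proof.
move=> z z1; have rhol := growth_rational_holomorphic.
have [[i zi]|nz] := pselect (exists i, (1 - RtoC Q * z ^ i.+1)%C = 0).
  by right; exact: (lambert_sum_pole SP rhol z1 zi).
by left; apply: (lambert_sum_holomorphic SP rhol z1) => i zi; apply: nz; exists i.
Qed.

Lemma growth_not_rational : 1 < Q -> ~ rational_near0 (fun z => growth_rational z + S z)%C.
Proof.
move=> Q1 [p [q [q0 pq]]].
apply: (lambert_sum_not_rational SP growth_rational_holomorphic growth_rational_rational Q1 (p := p) q0).
apply: filter_imp (filter_and _ _ (locally_locally' pq) (Cpoly_neq0_near (RtoC 0) q0)) => z [E qz].
by rewrite E //; field.
Qed.

(* If F = p / q, then z F' = H gives q^2 H = z (p' q - p q'). *)
Lemma CC_not_rational F : PSum (fun n => RtoC (INR (CC k n))) growth_radius F ->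
  1 < Q -> ~ rational_near0 F.
Proof.
move=> FP Q1 [p [q [q0 pq]]]; have [[r0 _] _] := growth_radius_bounds.
have [G FG _] := growth_derive FP.
have [p' dp] := Cpoly_derive p; have [q' dq] := Cpoly_derive q.
have [qq qqE] := Cpoly_mul q q.
have [a aE] := Cpoly_mul p' q; have [b bE] := Cpoly_mul p q'.
have [b' b'E] := Cpoly_scal (- RtoC 1)%C b; have [c cE] := Cpoly_add a b'.
have /locallyC'[d1 d10 qnz] := Cpoly_neq0_near (RtoC 0) q0.
have /locallyC[d2 d20 Fpq] := pq.
have qq0 : nonzero_poly qq.
  have [w wz w0] := punctured_point (RtoC 0) d10.
  by apply: (@nonzero_poly_eval qq w); rewrite qqE; apply: Cmult_neq_0; exact: qnz.
apply: (lambert_sum_not_rational SP growth_rational_holomorphic growth_rational_rational Q1 (p := RtoC 0 :: c) qq0).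
pose d := Rmin (Rmin d1 d2) growth_radius.
have d0 : 0 < d by apply: Rmin_pos => //; exact: Rmin_pos.
have dE w : Cmod w < d -> [/\ Cmod (w - 0) < d1, Cmod (w - 0) < d2 & Cmod w < growth_radius].
  have -> : (w - 0 = w)%C by ring.
  move=> wd; have [h1 h2] := Rmin_Rgt_l _ _ _ wd.
  by have [h3 h4] := Rmin_Rgt_l _ _ _ h1.
apply/locallyC'; exists d => // z zd z0.
have Ez : (z - 0 = z)%C by ring.
rewrite Ez in zd.
have [z1 z2 zr] := dE z zd; have [dF HG] := FG z zr.
have D1 := Cderive_mult (dq z) dF.
have D2 : Cderive (fun w => Cpoly_eval q w * F w)%C z (Cpoly_eval p' z).
  apply: (is_derive_ext_loc (V := C_NormedModule) (Cpoly_eval p)) (dp z).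
  apply/locally_C/locallyC.
  (* This disc around z stays in the disc of radius d and avoids 0, where q may vanish. *)
  exists (Rmin (d - Cmod z) (Cmod z)) => [|w wz].
    by apply: Rmin_pos; [lra | exact/Cmod_gt_0].
  have [h1 h2] := Rmin_Rgt_l _ _ _ wz.
  have wd : Cmod w < d.
    have := Cmod_triangle z (w - z); have -> : (z + (w - z) = w)%C by ring.
    lra.
  have w0 : w <> 0.
    move=> E; move: h2; rewrite E; have -> : (0 - z = - z)%C by ring.
    by rewrite Cmod_opp; lra.
  have [w1 w2 _] := dE w wd; have qw := qnz w w1 w0.
  by rewrite (Fpq w w2 qw); asC; field.
have E := Cderive_unique D1 D2.
have qz := qnz z z1 z0.
rewrite qqE HG /= cE aE b'E bE -E (Fpq z z2 qz); field.
by [].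
Qed.

(** * Integration along a segment *)

(** A chain rule across two scalar fields: the parameter is real, the derivative of f complex. The
    bounds use |z| + 1 because z may be 0. *)
Lemma Cderive_segment f z l (t : R) : Cderive f (RtoC t * z)%C l ->
  is_derive (K := R_AbsRing) (V := C_R_NormedModule) (fun s : R => f (RtoC s * z)%C) t (l * z)%C.
Proof.
move=> /is_deriveC df; split; first exact: is_linear_scal_l.
move=> x lim_x e.
have -> : x = t by apply/esym/(is_filter_lim_locally_unique (V := R_NormedModule)).
have z0 := Cmod_ge_0 z.
have e0 : 0 < e / (Cmod z + 1) by apply: Rdiv_lt_0_compat; [exact: cond_pos | lra].
have [d d0 dP] := df _ e0.
have d'0 : 0 < d / (Cmod z + 1) by apply: Rdiv_lt_0_compat; lra.
exists (mkposreal _ d'0) => s; rewrite /ball /= /AbsRing_ball /= /abs /minus /plus /opp /= => sd.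
rewrite -Cmod_norm.
have h1 : Cmod (RtoC s * z - RtoC t * z) = Rabs (s + - t) * Cmod z.
  have -> : (RtoC s * z - RtoC t * z = RtoC (s + - t) * z)%C by rewrite RtoC_plus RtoC_opp; ring.
  by rewrite Cmod_mult Cmod_R.
have a0 := Rabs_pos (s + - t).
have h2 : Rabs (s + - t) * (Cmod z + 1) < d.
  by move/(Rmult_lt_compat_r (Cmod z + 1) _ _ ltac:(lra)): sd; rewrite /Rdiv Rmult_assoc Rinv_l ?Rmult_1_r; lra.
have := dP (RtoC s * z)%C; rewrite h1 => /(_ ltac:(nra)).
rewrite scal_R_Cmult.
have -> : ((RtoC s * z - RtoC t * z) * l = RtoC (s + - t) * (l * z))%C by rewrite RtoC_plus RtoC_opp; ring.
move=> h; apply: Rle_trans h _.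
have -> : e / (Cmod z + 1) * (Rabs (s + - t) * Cmod z) = e * Rabs (s + - t) * (Cmod z / (Cmod z + 1)) by field; lra.
have : Cmod z / (Cmod z + 1) <= 1.
  by apply: (Rmult_le_reg_r (Cmod z + 1)); [lra | rewrite /Rdiv Rmult_assoc Rinv_l ?Rmult_1_r; lra].
have := cond_pos e => ep; have ea : 0 <= e * Rabs (s + - t) by apply: Rmult_le_pos; lra.
by move=> /(Rmult_le_compat_l _ _ _ ea); rewrite Rmult_1_r; apply.
Qed.

Lemma CC_segment_int F z : PSum (fun n => RtoC (INR (CC k n))) growth_radius F ->
  Cmod z < growth_radius ->
  is_segment_int (fun t => (growth_rational t + S t) / t)%C 0 z (F z - 1)%C.
Proof.
move=> FP zr; have [[r0 _] _] := growth_radius_bounds.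
have [G FG dG] := growth_derive FP.
have tz (t : R) : 0 <= t <= 1 -> Cmod (RtoC t * z) < growth_radius.
  move=> t01; rewrite Cmod_mult Cmod_R Rabs_pos_eq; last lra.
  by have := Cmod_ge_0 z; nra.
have F0 : F 0 = 1 by rewrite (PSum_at0 r0 FP) CC0.
(* Equality is required only for 0 < t < 1, so the default value of H(t)/t at t = 0 is harmless.
   After this replacement, F is a primitive along the segment. *)
apply: (is_RInt_ext (fun t : R => G (RtoC t * z) * z)%C) => [t|].
  rewrite Rmin_left ?Rmax_right; [|lra|lra] => t01.
  have -> : (0 + RtoC t * (z - 0) = RtoC t * z)%C by ring.
  have -> : (z - 0 = z)%C by ring.
  have [->|z0] := pselect (z = 0); first by rewrite !Cmult_0_r.
  have [_ ->] := FG (RtoC t * z)%C ltac:(apply: tz; lra).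
  have t0 : RtoC t <> 0 by move/RtoC_inj; lra.
  by asC; field.
have -> : (F z - 1)%C = minus (G := C_R_NormedModule) (F (RtoC 1 * z)%C) (F (RtoC 0 * z)%C).
  by rewrite Cmult_0_l Cmult_1_l F0.
apply: (is_RInt_derive (V := C_R_CompleteNormedModule) (fun t : R => F (RtoC t * z)%C)) => t.
  rewrite Rmin_left ?Rmax_right; [|lra|lra] => t01.
  by apply: Cderive_segment; case: (FG _ (tz t t01)).
rewrite Rmin_left ?Rmax_right; [|lra|lra] => t01.
have [l dl] := dG _ (tz t t01).
apply: ex_derive_continuous; eexists.
exact: (@Cderive_segment (fun w => G w * z)%C z _ t (Cderive_mult dl (Cderive_cst z _))).
Qed.

End ConjugacyGrowth.

Lemma growth_sum_exists k : exists S : C -> C,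
  forall z, Cmod z < 1 -> Cseries (fun i => lambert (2 * INR k - 1) i z) (S z).
Proof. exact: lambert_sum_exists. Qed.

End ComplexSeries.

Local Open Scope C_scope.

(* There are N_m = (2k-1)^m + 1 + (k-1)(1 + (-1)^m) cyclically reduced words of
   length m >= 1, and r CC(r) = \sum_(d | r) phi(d) N_(r/d).  The terms
   1 + (k-1)(1 + (-1)^m) of N_m contribute z/(1-z)^2 + 2(k-1)z^2/(1-z^2)^2.
   Since CC(0) = 1, the integral of H(t)/t is F - 1. *)
Theorem theorem14p6 (k : nat) :
  exists H F : C -> C,
    is_genfun (fun r => (r * CC k r)%N) H /\
    is_genfun (CC k) F /\
    meromorphic_on unit_disc H /\
    (forall z : C, unit_disc z -> ~ is_pole H z ->
       exists S : C,
         is_series (K := C_AbsRing) (V := C_NormedModule)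
           (fun n => let d := n.+1 in
              RtoC (INR (totient d)) *
                (1 / (1 - (2 * RtoC (INR k) - 1) * z ^ d) - 1)) S /\
         H z = z / (1 - z) ^ 2
               + 2 * (RtoC (INR k) - 1) * (z ^ 2 / (1 - z ^ 2) ^ 2) + S) /\
    ((1 < k)%N ->
       infinite_set [set z : C | unit_disc z /\ is_pole H z]%classic /\
       ~ rational_near0 H) /\
    locally (T := C_UniformSpace) (0 : C) (fun z =>
      exists I : C,
        is_segment_int (fun t => H t / t) 0 z I /\ F z = 1 + I) /\
    ((1 < k)%N -> ~ rational_near0 F).
Proof.
have [S SP] := growth_sum_exists k.
have [F FP] := CC_PSum SP.
have HP := growth_PSum SP.
exists (fun z => growth_rational k z + S z), F.
split; [|split; [|split; [|split; [|split; [|split]]]]].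
- by apply: (@locally_growth_radius k) => z zr; apply/is_pseriesC; have [_] := HP z zr.
- by apply: (@locally_growth_radius k) => z zr; apply/is_pseriesC; have [_] := FP z zr.
- exact: growth_meromorphic.
- move=> z z1 _; exists (S z); split=> //.
  apply: is_series_ext (SP z z1) => n.
  by rewrite /lambert RtoC_minus RtoC_mult.
- move=> /growth_base_gt1 Q1; split; last exact: growth_not_rational.
  exact: lambert_sum_infinite_poles (growth_rational_holomorphic k) Q1.
- apply: (@locally_growth_radius k) => z zr; exists (F z - 1); split; last ring.
  exact: (CC_segment_int SP FP zr).
- by move=> /growth_base_gt1; exact: CC_not_rational SP _ FP.
Qed.
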